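(* Suppose there exists an algorithm making $m(n,\varepsilon,\delta)$ queries which, given {\sf NACOND} access to an unknown distribution $p$ over $[n]$ and an explicit description of a distribution $q$ over $[n]$ with $\|q - \mathcal{U}_n\|_\infty \leq \frac{1}{100n}$, distinguishes between the cases $p = q$ and $d_{\mathrm{TV}}(p,q) \geq \varepsilon$ with probability at least $1 - \delta$. Then there exists an algorithm which, given {\sf NACOND} access to an unknown distribution $p$ on $[n]$ and an explicit description of an arbitrary distribution $q$ on $[n]$, makes $$O\left(\log (n/\varepsilon) \cdot m\left(n, \varepsilon/2, \frac{\log (1 + 1/100)}{6\log (100n/\varepsilon)}\right) + \frac{\sqrt{\log (n/\varepsilon)}}{\varepsilon^2}\right)$$ queries to the oracle on $p$ and distinguishes between the cases $p = q$ and $d_{\mathrm{TV}}(p,q) \geq \varepsilon$ with probability at least $2/3$.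
   Context: Distributions are over the finite domain $[n]=\{1,\dots,n\}$; $\mathcal{U}_n$ is the uniform distribution on $[n]$; $\|x\|_\infty=\max_i|x(i)|$. For $S\subseteq[n]$, $p(S)=\sum_{i\in S}p(i)$. A conditional sampling oracle for $p$ takes as input a query set $S\subseteq[n]$ and returns a symbol $i\in S$ drawn with probability $p(i)/p(S)$; if $p(S)=0$ it returns a uniformly random element of $S$. In the non-adaptive model ({\sf NACOND}), the algorithm must specify all of its query sets (possibly using its own randomness) before seeing the result of any query. Total variation distance: $d_{\mathrm{TV}}(p,q)=\frac12\sum_{i\in[n]}|p(i)-q(i)|$. $\log$ is base 2. *)

(* Defs.v *)
From Stdlib Require Import Reals List.
Open Scope R_scope.

(* The domain [n] = {1,...,n} is represented by the indices 0,...,n-1. *)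

Fixpoint rsum (n : nat) (f : nat -> R) : R :=
  match n with
  | O => 0
  | S k => rsum k f + f k
  end.

Definition is_dist (n : nat) (p : nat -> R) : Prop :=
  (forall i, (i < n)%nat -> 0 <= p i) /\ rsum n p = 1.

Definition log2 (x : R) : R := ln x / ln 2.

Definition dTV (n : nat) (p q : nat -> R) : R :=
  / 2 * rsum n (fun i => Rabs (p i - q i)).

Definition near_uniform (n : nat) (q : nat -> R) : Prop :=
  forall i, (i < n)%nat -> Rabs (q i - / INR n) <= / (100 * INR n).

(* A query set S ⊆ [n] is given by a boolean predicate; its elements are the
   i < n with S i = true.  Query sets must be nonempty. *)
Definition qset := nat -> bool.

Definition nonempty_qset (n : nat) (S : qset) : Prop :=
  exists i, (i < n)%nat /\ S i = true.

Definition massS (n : nat) (p : nat -> R) (S : qset) : R :=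
  rsum n (fun i => if S i then p i else 0).

Definition sizeS (n : nat) (S : qset) : R :=
  rsum n (fun i => if S i then 1 else 0).

Definition cond_prob (n : nat) (p : nat -> R) (S : qset) (i : nat) : R :=
  if S i then
    (if Req_dec_T (massS n p S) 0 then / sizeS n S else p i / massS n p S)
  else 0.

(* A deterministic non-adaptive strategy: a fixed list of query sets, and a
   decision (true = accept "p = q") computed from the list of answers. *)
Record strategy := mkStrategy {
  queries : list qset;
  decide  : list nat -> bool
}.

Fixpoint accept_det (n : nat) (p : nat -> R) (Qs : list qset)
    (D : list nat -> bool) : R :=
  match Qs with
  | nil => if D nil then 1 else 0
  | Q :: Qs' =>
      rsum n (fun i => cond_prob n p Q i *
                       accept_det n p Qs' (fun ans => D (i :: ans)))
  end.

(* A randomized NACOND tester: a finite probability mixture over strategies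
   (the internal randomness is drawn before any query is answered). *)
Definition tester := list (R * strategy).

Definition valid_tester (n : nat) (T : tester) : Prop :=
  Forall (fun ws => 0 <= fst ws /\ Forall (nonempty_qset n) (queries (snd ws))) T
  /\ fold_right (fun ws acc => fst ws + acc) 0 T = 1.

Definition queries_at_most (T : tester) (b : R) : Prop :=
  Forall (fun ws => INR (length (queries (snd ws))) <= b) T.

Definition accept_prob (n : nat) (p : nat -> R) (T : tester) : R :=
  fold_right (fun ws acc =>
     fst ws * accept_det n p (queries (snd ws)) (decide (snd ws)) + acc) 0 T.

Definition distinguishes (n : nat) (q : nat -> R) (eps delta : R) (T : tester)
  : Prop :=
  (forall p, is_dist n p -> (forall i, (i < n)%nat -> p i = q i) ->
     accept_prob n p T >= 1 - delta) /\
  (forall p, is_dist n p -> dTV n p q >= eps ->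
     1 - accept_prob n p T >= 1 - delta).

(* Main.v *)
(* Running the given tester on buckets of q would require bounds on m at sizes
   smaller than n, and m is not assumed to be monotone.  Only the lower bound that
   the hypothesis forces on m is used: a tester of uniformity needs
   c log(1/delta) / eps^2 queries, because the likelihood ratio of one conditional
   answer between the uniform distribution and a two-valued perturbation of it has
   second moment 1 + O(eps^2).  With L = log (n / eps), the prescribed delta is of
   order 1 / L, so L * m is at least of order L (1 + log L) / eps^2, and this many
   queries suffice for testing identity to an arbitrary q.

   For the upper bound, call "coin" a query set together with a subset of it, and
   sort [n] into about L dyadic buckets according to the value of q.  If p is
   eps-far from q, then one of three random coins has a bias that differs under p
   and q: either
   - a random union of buckets, inside [n], deviates by eps / sqrt L on average
     (the masses of the buckets differ); or
   - a random pair of elements of a bucket deviates by eps on average (the two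
     distributions differ inside buckets by bounded ratios); or
   - a random bisection of a random subset of a bucket, of random density 2^-l,
     deviates by a constant with probability eps / L (elements whose p-mass is
     much larger than their q-mass are found at the density where they carry a
     constant fraction of the p-mass of the subset).  *)

Require Import Defs.
From Stdlib Require Import Reals List Lra Lia Psatz FunctionalExtensionality.
Import ListNotations.
Open Scope R_scope.

(** * Finite sums *)

(** The three tests cost about L / eps^2, 1 / eps^2 and (L / eps) log (L / eps) queries. The first
    two know only a mean deviation d over random coins, not whether it comes from many small
    deviations or from few large ones; since the rejection exponents of all dyadic scales add up,
    trying every scale still costs O(1 / d^2), without a logarithmic factor. The third test pays a
    logarithm because none of its roughly L / eps coins may err when p = q. Its ln (1 / eps) is
    absorbed by the spare factor 1 / eps, and its ln L is what the prescribed delta pays for, as ln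
    (1 / (2 delta)) >= 1 + ln L. The split coins are forced by a weakness of the pair coins: a pair
    shows only the relative difference of two ratios p / q, so a few huge ratios can carry the whole
    distance and be met too rarely. Ratios are therefore truncated at 100, and the mass lost by
    truncation, [heavy_part], is left to the splits. An element holding a fraction of about 2^-l of
    its bucket's p-mass is exposed at density about 2^-l; guessing l among about L values costs the
    factor L in eps / L. *)

Lemma rsum_S n f : rsum (S n) f = rsum n f + f n.
Proof. reflexivity. Qed.

Lemma rsum_ext n f g :
  (forall i, (i < n)%nat -> f i = g i) -> rsum n f = rsum n g.
Proof.
  induction n as [|n IH]; simpl; intros H; [reflexivity|].
  rewrite IH by (intros; apply H; lia). rewrite H by lia. reflexivity.
Qed.

Lemma rsum_le n f g :
  (forall i, (i < n)%nat -> f i <= g i) -> rsum n f <= rsum n g.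
Proof.
  induction n as [|n IH]; simpl; intros H; [lra|].
  apply Rplus_le_compat; [apply IH; intros; apply H; lia | apply H; lia].
Qed.

Lemma rsum_0 n : rsum n (fun _ => 0) = 0.
Proof. induction n as [|n IH]; simpl; lra. Qed.

Lemma rsum_nonneg n f : (forall i, (i < n)%nat -> 0 <= f i) -> 0 <= rsum n f.
Proof. intros H. rewrite <- (rsum_0 n). now apply rsum_le. Qed.

Lemma rsum_plus n f g :
  rsum n (fun i => f i + g i) = rsum n f + rsum n g.
Proof. induction n as [|n IH]; simpl; [lra|]. rewrite IH; lra. Qed.

Lemma rsum_scal n c f : rsum n (fun i => c * f i) = c * rsum n f.
Proof. induction n as [|n IH]; simpl; [lra|]. rewrite IH; lra. Qed.

Lemma rsum_scal_r n c f : rsum n (fun i => f i * c) = rsum n f * c.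
Proof. induction n as [|n IH]; simpl; [lra|]. rewrite IH; lra. Qed.

Lemma rsum_minus n f g :
  rsum n (fun i => f i - g i) = rsum n f - rsum n g.
Proof. induction n as [|n IH]; simpl; [lra|]. rewrite IH; lra. Qed.

Lemma rsum_const n c : rsum n (fun _ => c) = INR n * c.
Proof. induction n as [|n IH]; [simpl; lra|]. rewrite S_INR; simpl; rewrite IH; lra. Qed.

Lemma rsum_swap n m f :
  rsum n (fun i => rsum m (fun j => f i j)) =
  rsum m (fun j => rsum n (fun i => f i j)).
Proof.
  induction n as [|n IH]; simpl.
  - symmetry; apply rsum_0.
  - rewrite IH, <- rsum_plus. reflexivity.
Qed.

Lemma rsum_Rabs n f : Rabs (rsum n f) <= rsum n (fun i => Rabs (f i)).
Proof.
  induction n as [|n IH]; simpl; [rewrite Rabs_R0; lra|].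
  eapply Rle_trans; [apply Rabs_triang|]. lra.
Qed.

Lemma rsum_delta n i v :
  (i < n)%nat -> rsum n (fun j => if (i =? j)%nat then v else 0) = v.
Proof.
  induction n as [|n IH]; intros Hi; [lia|]. simpl.
  destruct (Nat.eqb_spec i n) as [->|Hne].
  - rewrite (rsum_ext n _ (fun _ => 0)); [rewrite rsum_0; lra|].
    intros j Hj. destruct (Nat.eqb_spec n j); [lia|reflexivity].
  - rewrite IH by lia. lra.
Qed.

Lemma rsum_split n i f :
  (i < n)%nat ->
  rsum n f = f i + rsum n (fun j => if (i =? j)%nat then 0 else f j).
Proof.
  intros Hi. rewrite <- (rsum_delta n i (f i)) at 1 by assumption.
  rewrite <- rsum_plus. apply rsum_ext; intros j _.
  destruct (Nat.eqb_spec i j) as [->|]; lra.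
Qed.

Lemma rsum_term_le n i f :
  (forall j, (j < n)%nat -> 0 <= f j) -> (i < n)%nat -> f i <= rsum n f.
Proof.
  intros Hf Hi. rewrite (rsum_split n i f Hi).
  assert (0 <= rsum n (fun j => if (i =? j)%nat then 0 else f j)); [|lra].
  apply rsum_nonneg; intros j Hj. destruct (i =? j)%nat; [lra|auto].
Qed.

Lemma rsum_Cauchy_Schwarz n f g :
  (rsum n (fun i => f i * g i)) ^ 2 <=
  rsum n (fun i => f i ^ 2) * rsum n (fun i => g i ^ 2).
Proof.
  set (A := rsum n (fun i => f i ^ 2)). set (B := rsum n (fun i => g i ^ 2)).
  set (C := rsum n (fun i => f i * g i)).
  assert (H : forall s t, 0 <= s ^ 2 * A - 2 * s * t * C + t ^ 2 * B).
  { intros s t.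
    replace (s ^ 2 * A - 2 * s * t * C + t ^ 2 * B)
      with (rsum n (fun i => (s * f i - t * g i) ^ 2)).
    - apply rsum_nonneg; intros; apply pow2_ge_0.
    - unfold A, B, C. rewrite <- !rsum_scal, <- rsum_minus, <- rsum_plus.
      apply rsum_ext; intros; ring. }
  assert (HA : 0 <= A) by (apply rsum_nonneg; intros; apply pow2_ge_0).
  destruct (Req_dec A 0) as [HA0|HA0].
  - destruct (Req_dec C 0) as [->|HC]; [rewrite HA0; lra|].
    (* Here A = 0 and C <> 0, and this choice gives the form the value -1. *)
    pose proof (H ((B + 1) / (2 * C)) 1) as H1. rewrite HA0 in H1.
    replace (2 * ((B + 1) / (2 * C)) * 1 * C) with (B + 1) in H1 by (field; lra).
    exfalso. nra.
  (* At s = C, t = A the form equals A (A B - C^2). *)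
  - pose proof (H C A) as H1. assert (0 < A) by lra.
    apply Rmult_le_reg_l with A; [assumption|]. nra.
Qed.

(** * Finitely supported measures *)

(** Weighted lists are the format of [tester], so a random coin becomes a randomized tester through
    [bind]. Weights are not normalised; total mass 1 is stated separately as
    [Ex d (fun _ => 1) = 1]. *)
Definition Ex {A : Type} (d : list (R * A)) (f : A -> R) : R :=
  fold_right (fun wa acc => fst wa * f (snd wa) + acc) 0 d.

Definition supp {A : Type} (P : A -> Prop) (d : list (R * A)) : Prop :=
  Forall (fun wa => 0 <= fst wa /\ P (snd wa)) d.

Definition ret {A : Type} (a : A) : list (R * A) := [(1, a)].

Definition bind {A B : Type} (d : list (R * A)) (k : A -> list (R * B)) :
  list (R * B) :=
  flat_map (fun wa => map (fun vb => (fst wa * fst vb, snd vb)) (k (snd wa))) d.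

Definition weights (n : nat) (w : nat -> R) : list (R * nat) :=
  map (fun i => (w i, i)) (seq 0 n).

Section Measures.
Context {A B : Type}.
Implicit Types (d : list (R * A)) (f g : A -> R).

Lemma Ex_app d1 d2 f : Ex (d1 ++ d2) f = Ex d1 f + Ex d2 f.
Proof. induction d1 as [|x d1 IH]; simpl; [lra|]. unfold Ex in *; simpl; rewrite IH; lra. Qed.

Lemma Ex_plus d f g : Ex d (fun a => f a + g a) = Ex d f + Ex d g.
Proof. induction d as [|x d IH]; unfold Ex in *; simpl; [lra|]. rewrite IH; lra. Qed.

Lemma Ex_scal d c f : Ex d (fun a => c * f a) = c * Ex d f.
Proof. induction d as [|x d IH]; unfold Ex in *; simpl; [lra|]. rewrite IH; lra. Qed.

Lemma Ex_minus d f g : Ex d (fun a => f a - g a) = Ex d f - Ex d g.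
Proof. induction d as [|x d IH]; unfold Ex in *; simpl; [lra|]. rewrite IH; lra. Qed.

Lemma Ex_ext d f g : (forall a, f a = g a) -> Ex d f = Ex d g.
Proof. intros H. induction d as [|x d IH]; unfold Ex in *; simpl; [lra|]. rewrite IH, H; lra. Qed.

Lemma Ex_le P d f g :
  supp P d -> (forall a, P a -> f a <= g a) -> Ex d f <= Ex d g.
Proof.
  intros Hd H. induction Hd as [|x d [Hx HP] _ IH]; unfold Ex in *; simpl; [lra|].
  apply Rplus_le_compat; [|exact IH]. apply Rmult_le_compat_l; auto.
Qed.

Lemma Ex_const d c : Ex d (fun _ => c) = c * Ex d (fun _ => 1).
Proof. rewrite <- Ex_scal. apply Ex_ext; intros; lra. Qed.

Lemma Ex_nonneg P d f :
  supp P d -> (forall a, P a -> 0 <= f a) -> 0 <= Ex d f.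
Proof.
  intros Hd H. replace 0 with (Ex d (fun _ => 0)) by (rewrite Ex_const; lra).
  now apply Ex_le with P.
Qed.

Lemma Ex_rsum d n (f : A -> nat -> R) :
  Ex d (fun a => rsum n (f a)) = rsum n (fun i => Ex d (fun a => f a i)).
Proof.
  induction n as [|n IH]; simpl; [rewrite Ex_const; lra|].
  now rewrite Ex_plus, IH.
Qed.

Lemma Ex_bind d (k : A -> list (R * B)) (f : B -> R) :
  Ex (bind d k) f = Ex d (fun a => Ex (k a) f).
Proof.
  induction d as [|[w a] d IH]; [reflexivity|].
  change (bind ((w, a) :: d) k)
    with (map (fun vb => (w * fst vb, snd vb)) (k a) ++ bind d k).
  assert (E : Ex (map (fun vb => (w * fst vb, snd vb)) (k a)) f = w * Ex (k a) f).
  { induction (k a) as [|x l IHl]; unfold Ex in *; simpl; [lra|]. rewrite IHl; lra. }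
  unfold Ex at 2. simpl. fold (Ex d (fun a => Ex (k a) f)).
  rewrite <- IH, <- E. clear.
  induction (map _ (k a)) as [|x l IHl]; unfold Ex in *; simpl; [lra|]. rewrite IHl; lra.
Qed.

Lemma Ex_ret (a : A) f : Ex (ret a) f = f a.
Proof. unfold Ex; simpl; lra. Qed.

Lemma supp_ret (P : A -> Prop) a : P a -> supp P (ret a).
Proof. intros H. constructor; [simpl; split; [lra|exact H] | constructor]. Qed.

Lemma supp_bind (P : A -> Prop) (P' : B -> Prop) d k :
  supp P d -> (forall a, P a -> supp P' (k a)) -> supp P' (bind d k).
Proof.
  intros Hd Hk. induction Hd as [|[w a] d [Hw HP] _ IH]; [constructor|].
  apply Forall_app; split; [|exact IH]. simpl in *.
  specialize (Hk a HP). apply Forall_map.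
  eapply Forall_impl; [|exact Hk]. simpl; intros [v b] [Hv Hb]; simpl in *.
  split; [nra|exact Hb].
Qed.

Lemma supp_impl (P P' : A -> Prop) d :
  (forall a, P a -> P' a) -> supp P d -> supp P' d.
Proof. intros H. apply Forall_impl. intros wa [? ?]; auto. Qed.

Lemma Ex_Jensen_sq P d f :
  supp P d -> Ex d (fun _ => 1) = 1 -> (Ex d f) ^ 2 <= Ex d (fun a => f a ^ 2).
Proof.
  intros Hd H1. set (m := Ex d f).
  assert (H : 0 <= Ex d (fun a => (f a - m) ^ 2)).
  { apply Ex_nonneg with P; [assumption|]. intros; apply pow2_ge_0. }
  rewrite (Ex_ext d _ (fun a => (f a ^ 2 - 2 * m * f a) + m ^ 2 * 1)) in H
    by (intros; ring).
  rewrite Ex_plus, Ex_minus, !Ex_scal, H1 in H. fold m in H. lra.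
Qed.

End Measures.

Lemma Ex_weights n w f : Ex (weights n w) f = rsum n (fun i => w i * f i).
Proof.
  unfold weights. induction n as [|n IH]; [reflexivity|].
  rewrite seq_S, map_app, Ex_app, IH. simpl. unfold Ex; simpl. lra.
Qed.

Lemma supp_weights n w :
  (forall i, (i < n)%nat -> 0 <= w i) -> supp (fun i => (i < n)%nat) (weights n w).
Proof.
  intros H. apply Forall_map, Forall_forall. intros i Hi.
  apply in_seq in Hi. simpl. split; [apply H|]; lia.
Qed.

Lemma Ex_comm {A B : Type} (d : list (R * A)) (d' : list (R * B)) f :
  Ex d (fun a => Ex d' (fun b => f a b)) = Ex d' (fun b => Ex d (fun a => f a b)).
Proof.
  induction d as [|x d IH].
  - rewrite (Ex_ext d' (fun b => Ex [] (fun a => f a b)) (fun _ => 0)) by reflexivity.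
    rewrite Ex_const; unfold Ex; simpl; lra.
  - unfold Ex at 1; simpl. fold (Ex d (fun a => Ex d' (fun b => f a b))).
    rewrite IH, <- Ex_scal, <- Ex_plus. reflexivity.
Qed.

(** * Product measures *)

Definition upd {A : Type} (g : nat -> A) (i : nat) (a : A) : nat -> A :=
  fun j => if (i =? j)%nat then a else g j.

(** The law of n independent draws from [D], seen as functions on [nat]; [a0] fills the indices from
    n on. *)
Fixpoint prodm {A : Type} (a0 : A) (D : list (R * A)) (n : nat) :
  list (R * (nat -> A)) :=
  match n with
  | O => ret (fun _ => a0)
  | S k => bind (prodm a0 D k) (fun g => bind D (fun a => ret (upd g k a)))
  end.

Lemma upd_same {A} (g : nat -> A) i a : upd g i a i = a.
Proof. unfold upd. now rewrite Nat.eqb_refl. Qed.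

Lemma upd_other {A} (g : nat -> A) i a j : i <> j -> upd g i a j = g j.
Proof. unfold upd. intros H. now apply Nat.eqb_neq in H as ->. Qed.

Section Product.
Context {A : Type} (a0 : A) (D : list (R * A)).
Context (D_nonneg : supp (fun _ => True) D).
Context (D_mass : Ex D (fun _ => 1) = 1).

Lemma Ex_prodm_S n f :
  Ex (prodm a0 D (S n)) f =
  Ex (prodm a0 D n) (fun g => Ex D (fun a => f (upd g n a))).
Proof.
  simpl. rewrite Ex_bind. apply Ex_ext; intros g.
  rewrite Ex_bind. apply Ex_ext; intros a. apply Ex_ret.
Qed.

Lemma supp_prodm n : supp (fun _ => True) (prodm a0 D n).
Proof.
  induction n as [|n IH]; simpl; [now apply supp_ret|].
  apply supp_bind with (fun _ => True); [exact IH|]. intros g _.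
  apply supp_bind with (fun _ => True); [exact D_nonneg|]. intros a _.
  now apply supp_ret.
Qed.

Lemma prodm_mass n : Ex (prodm a0 D n) (fun _ => 1) = 1.
Proof.
  induction n as [|n IH]; [simpl; apply Ex_ret|].
  rewrite Ex_prodm_S, (Ex_ext _ _ (fun _ => 1)); auto.
Qed.

Lemma Ex_D_const c : Ex D (fun _ => c) = c.
Proof. rewrite Ex_const, D_mass; lra. Qed.

(** Coordinates are independent, so one of them may be redrawn. This is how [heavy_detected]
    conditions on the whole split except the side of one element. *)
Lemma prodm_resample n i f :
  (i < n)%nat ->
  Ex (prodm a0 D n) f =
  Ex (prodm a0 D n) (fun g => Ex D (fun a => f (upd g i a))).
Proof.
  revert f. induction n as [|n IH]; intros f Hi; [lia|].
  rewrite !Ex_prodm_S. destruct (Nat.eq_dec i n) as [->|Hne].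
  - apply Ex_ext; intros g.
    rewrite (Ex_ext D (fun a => Ex D (fun b => f (upd (upd g n a) n b)))
               (fun _ => Ex D (fun b => f (upd g n b)))).
    + now rewrite Ex_D_const.
    + intros a. apply Ex_ext; intros b. f_equal.
      extensionality j. unfold upd. now destruct (n =? j)%nat.
  - rewrite IH by lia. apply Ex_ext; intros g.
    rewrite Ex_comm. apply Ex_ext; intros a. apply Ex_ext; intros b.
    f_equal. extensionality j. unfold upd.
    destruct (Nat.eqb_spec n j), (Nat.eqb_spec i j); congruence.
Qed.

Lemma rsum_upd n (phi : nat -> A -> R) g a :
  rsum n (fun j => phi j (upd g n a j)) = rsum n (fun j => phi j (g j)).
Proof. apply rsum_ext; intros j Hj. rewrite upd_other by lia. reflexivity. Qed.

Lemma prodm_mean n (phi : nat -> A -> R) :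
  Ex (prodm a0 D n) (fun g => rsum n (fun j => phi j (g j))) =
  rsum n (fun j => Ex D (phi j)).
Proof.
  induction n as [|n IH]; [simpl; apply Ex_ret|].
  rewrite Ex_prodm_S, !rsum_S. rewrite <- IH.
  rewrite (Ex_ext _ _ (fun g => rsum n (fun j => phi j (g j)) + Ex D (phi n))).
  - rewrite Ex_plus, (Ex_const _ (Ex D _)), prodm_mass; lra.
  - intros g. rewrite (Ex_ext D _ (fun a => rsum n (fun j => phi j (g j)) + phi n a)).
    + now rewrite Ex_plus, Ex_D_const.
    + intros a. now rewrite rsum_S, rsum_upd, upd_same.
Qed.

(** Cross terms vanish because the summands are independent and centred. *)
Lemma prodm_second_moment n (phi : nat -> A -> R) :
  (forall j, (j < n)%nat -> Ex D (phi j) = 0) ->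
  Ex (prodm a0 D n) (fun g => rsum n (fun j => phi j (g j)) ^ 2) =
  rsum n (fun j => Ex D (fun a => phi j a ^ 2)).
Proof.
  induction n as [|n IH]; intros H0; [unfold Ex; simpl; lra|].
  rewrite Ex_prodm_S, !rsum_S. rewrite <- IH by (intros; apply H0; lia).
  rewrite (Ex_ext _ _ (fun g => rsum n (fun j => phi j (g j)) ^ 2
                                + Ex D (fun a => phi n a ^ 2))).
  - rewrite Ex_plus, (Ex_const _ (Ex D _)), prodm_mass; lra.
  - intros g. set (z := rsum n (fun j => phi j (g j))).
    rewrite (Ex_ext D _ (fun a => z ^ 2 + 2 * z * phi n a + phi n a ^ 2)).
    + rewrite !Ex_plus, Ex_D_const, Ex_scal, H0 by lia. lra.
    + intros a. rewrite rsum_S, rsum_upd, upd_same. fold z. ring.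
Qed.

End Product.

(** * Random signs and Khintchine's inequality *)

Definition signs : list (R * bool) := [(/ 2, true); (/ 2, false)].

Definition sgn (b : bool) : R := if b then 1 else -1.

Lemma Ex_signs f : Ex signs f = (f true + f false) / 2.
Proof. unfold Ex; simpl; lra. Qed.

Lemma supp_signs : supp (fun _ => True) signs.
Proof. repeat constructor; simpl; lra. Qed.

Lemma signs_mass : Ex signs (fun _ => 1) = 1.
Proof. rewrite Ex_signs; lra. Qed.

Lemma rademacher_second n x :
  Ex (prodm true signs n) (fun g => rsum n (fun j => x j * sgn (g j)) ^ 2) =
  rsum n (fun j => x j ^ 2).
Proof.
  rewrite (prodm_second_moment true signs signs_mass n (fun j b => x j * sgn b)).
  - apply rsum_ext; intros j _. rewrite Ex_signs; simpl; lra.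
  - intros j _. rewrite Ex_signs; simpl; lra.
Qed.

(** Averaging over the last sign cancels the odd powers. With s the sum of the earlier squares, the
    left side grows by 6 x_n^2 s + x_n^4 and the right side by 6 x_n^2 s + 3 x_n^4. *)
Lemma rademacher_fourth n x :
  Ex (prodm true signs n) (fun g => rsum n (fun j => x j * sgn (g j)) ^ 4) <=
  3 * rsum n (fun j => x j ^ 2) ^ 2.
Proof.
  induction n as [|n IH]; [unfold Ex; simpl; lra|].
  rewrite Ex_prodm_S, !rsum_S.
  rewrite (Ex_ext _ _ (fun g => (rsum n (fun j => x j * sgn (g j)) ^ 4
    + 6 * x n ^ 2 * rsum n (fun j => x j * sgn (g j)) ^ 2) + x n ^ 4)).
  - rewrite !Ex_plus, Ex_scal, rademacher_second, Ex_const, prodm_mass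
      by apply signs_mass.
    assert (0 <= x n ^ 4) by (replace (x n ^ 4) with ((x n ^ 2) ^ 2) by ring; apply pow2_ge_0).
    nra.
  - intros g. rewrite Ex_signs.
    rewrite !rsum_S, !(rsum_upd n (fun j b => x j * sgn b)), !upd_same. simpl sgn. field.
Qed.

(* The tangent bound |t| >= 1.2 t^2 - 0.3 t^4 turns the second and fourth
   moments into a lower bound on the first absolute moment. *)
Lemma Khintchine_L1 n x s :
  0 < s -> s ^ 2 = rsum n (fun j => x j ^ 2) ->
  3 / 10 * s <=
  Ex (prodm true signs n) (fun g => Rabs (rsum n (fun j => x j * sgn (g j)))).
Proof.
  intros Hs Hs2.
  assert (H : forall z, 12 / 10 / s * z ^ 2 - 3 / 10 / s ^ 3 * z ^ 4 <= Rabs z).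
  { intros z. rewrite <- (pow2_abs z).
    replace (z ^ 4) with ((Rabs z ^ 2) ^ 2) by (rewrite pow2_abs; ring).
    assert (0 <= Rabs z) by apply Rabs_pos. set (y := Rabs z) in *.
    set (t := y / s). assert (0 <= t) by (apply Rle_mult_inv_pos; lra).
    replace y with (t * s) by (unfold t; field; lra).
    replace (12 / 10 / s * (t * s) ^ 2 - 3 / 10 / s ^ 3 * ((t * s) ^ 2) ^ 2)
      with (s * (12 / 10 * t ^ 2 - 3 / 10 * t ^ 4)) by (field; lra).
    rewrite (Rmult_comm t s). apply Rmult_le_compat_l; [lra|].
    assert (0 <= 1 - 12 / 10 * t + 3 / 10 * t ^ 3); [|nra].
    (* A hint for [nra]: 1.155 approximates 2 / sqrt 3, the positive minimiser of the cubic. *)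
    assert (0 <= (t + 2) * (t - 1155 / 1000) ^ 2) by (apply Rmult_le_pos; [lra|apply pow2_ge_0]).
    nra. }
  eapply Rle_trans; [|apply Ex_le with (P := fun _ => True);
    [apply supp_prodm, supp_signs | intros g _; apply H]].
  rewrite Ex_minus, !Ex_scal, rademacher_second, <- Hs2.
  pose proof (rademacher_fourth n x) as H4. rewrite <- Hs2 in H4.
  assert (0 < / s ^ 3) by (apply Rinv_0_lt_compat, pow_lt, Hs).
  apply Rle_trans with (12 / 10 / s * s ^ 2 - 3 / 10 / s ^ 3 * (3 * (s ^ 2) ^ 2)).
  - right. field. lra.
  - apply Rplus_le_compat_l, Ropp_le_contravar.
    apply Rmult_le_compat_l; [unfold Rdiv; nra|exact H4].
Qed.

(** * The conditional oracle *)

Lemma sizeS_pos n S : nonempty_qset n S -> 0 < sizeS n S.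
Proof.
  intros [i [Hi HS]]. unfold sizeS.
  apply Rlt_le_trans with (if S i then 1 else 0); [rewrite HS; lra|].
  apply (rsum_term_le n i (fun i => if S i then 1 else 0)); [|exact Hi].
  intros j _. destruct (S j); lra.
Qed.

Lemma massS_nonneg n p S :
  (forall i, (i < n)%nat -> 0 <= p i) -> 0 <= massS n p S.
Proof. intros H. apply rsum_nonneg; intros i Hi. destruct (S i); [auto|lra]. Qed.

Lemma cond_prob_nonneg n p S i :
  (forall i, (i < n)%nat -> 0 <= p i) -> nonempty_qset n S -> (i < n)%nat ->
  0 <= cond_prob n p S i.
Proof.
  intros Hp HS Hi. unfold cond_prob. destruct (S i); [|lra].
  destruct (Req_dec_T (massS n p S) 0) as [|H0].
  - left. now apply Rinv_0_lt_compat, sizeS_pos.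
  - apply Rle_mult_inv_pos; [auto|]. pose proof (massS_nonneg n p S Hp). lra.
Qed.

Lemma cond_prob_mass n p S :
  nonempty_qset n S -> rsum n (cond_prob n p S) = 1.
Proof.
  intros HS. unfold cond_prob.
  destruct (Req_dec_T (massS n p S) 0) as [|H0].
  - rewrite (rsum_ext n _ (fun i => (if S i then 1 else 0) * / sizeS n S)).
    + rewrite rsum_scal_r. fold (sizeS n S). pose proof (sizeS_pos n S HS). field; lra.
    + intros i _. destruct (S i); lra.
  - rewrite (rsum_ext n _ (fun i => (if S i then p i else 0) * / massS n p S)).
    + rewrite rsum_scal_r. fold (massS n p S). field; lra.
    + intros i _. destruct (S i); unfold Rdiv; lra.
Qed.

Lemma cond_prob_ext n p q S i :
  (forall i, (i < n)%nat -> p i = q i) -> (i < n)%nat ->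
  cond_prob n p S i = cond_prob n q S i.
Proof.
  intros H Hi. unfold cond_prob. rewrite (H i Hi).
  replace (massS n p S) with (massS n q S); [reflexivity|].
  apply rsum_ext; intros j Hj. now rewrite H.
Qed.

Definition b2R (b : bool) : R := if b then 1 else 0.

(* A coin is a pair of sets: query the first one, and call the answer heads
   when it lies in the second one. *)
Definition coin : Type := (qset * qset)%type.

Definition heads_prob (n : nat) (p : nat -> R) (c : coin) : R :=
  rsum n (fun i => cond_prob n p (fst c) i * b2R (snd c i)).

Lemma heads_prob_ext n p q c :
  (forall i, (i < n)%nat -> p i = q i) -> heads_prob n p c = heads_prob n q c.
Proof. intros H. apply rsum_ext; intros i Hi. now rewrite (cond_prob_ext n p q). Qed.

Lemma heads_prob_range n p c :
  (forall i, (i < n)%nat -> 0 <= p i) -> nonempty_qset n (fst c) ->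
  0 <= heads_prob n p c <= 1.
Proof.
  intros Hp HS. unfold heads_prob. split.
  - apply rsum_nonneg; intros i Hi.
    pose proof (cond_prob_nonneg n p (fst c) i Hp HS Hi).
    destruct (snd c i); simpl; lra.
  - rewrite <- (cond_prob_mass n p (fst c) HS). apply rsum_le; intros i Hi.
    pose proof (cond_prob_nonneg n p (fst c) i Hp HS Hi).
    destruct (snd c i); simpl; lra.
Qed.

Lemma heads_prob_ratio n p Q A :
  massS n p Q <> 0 ->
  heads_prob n p (Q, A) = massS n p (fun i => Q i && A i)%bool / massS n p Q.
Proof.
  intros H. unfold heads_prob, cond_prob; simpl.
  destruct (Req_dec_T (massS n p Q) 0) as [|_]; [contradiction|].
  unfold massS at 2, Rdiv. rewrite <- rsum_scal_r. apply rsum_ext; intros i _.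
  destruct (Q i), (A i); simpl; unfold Rdiv; ring.
Qed.

(** * Expectations over the answers to a list of queries *)

(** Generalises [accept_det] from decisions to real functions of the answers, since concentration
    needs exponential moments of the number of heads. *)
Fixpoint edet (n : nat) (p : nat -> R) (Qs : list qset) (f : list nat -> R) : R :=
  match Qs with
  | [] => f []
  | Q :: Qs' =>
      rsum n (fun i => cond_prob n p Q i * edet n p Qs' (fun ans => f (i :: ans)))
  end.

Lemma accept_det_edet n p Qs D :
  accept_det n p Qs D = edet n p Qs (fun ans => b2R (D ans)).
Proof.
  revert D; induction Qs as [|Q Qs IH]; intros D; [reflexivity|].
  simpl. apply rsum_ext; intros i _. now rewrite IH.
Qed.

Lemma edet_ext n p Qs f g :
  (forall ans, f ans = g ans) -> edet n p Qs f = edet n p Qs g.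
Proof.
  revert f g; induction Qs as [|Q Qs IH]; intros f g H; simpl; [auto|].
  apply rsum_ext; intros i _. f_equal. apply IH; auto.
Qed.

Lemma edet_le n p Qs f g :
  (forall i, (i < n)%nat -> 0 <= p i) -> Forall (nonempty_qset n) Qs ->
  (forall ans, f ans <= g ans) -> edet n p Qs f <= edet n p Qs g.
Proof.
  intros Hp HQ. revert f g; induction HQ as [|Q Qs HQ _ IH]; intros f g H; simpl; [auto|].
  apply rsum_le; intros i Hi. apply Rmult_le_compat_l; [|now apply IH].
  now apply cond_prob_nonneg.
Qed.

Lemma edet_plus n p Qs f g :
  edet n p Qs (fun ans => f ans + g ans) = edet n p Qs f + edet n p Qs g.
Proof.
  revert f g; induction Qs as [|Q Qs IH]; intros f g; simpl; [auto|].
  rewrite <- rsum_plus. apply rsum_ext; intros i _. rewrite IH; lra.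
Qed.

Lemma edet_scal n p Qs c f :
  edet n p Qs (fun ans => c * f ans) = c * edet n p Qs f.
Proof.
  revert f; induction Qs as [|Q Qs IH]; intros f; simpl; [auto|].
  rewrite <- rsum_scal. apply rsum_ext; intros i _. rewrite IH; lra.
Qed.

Lemma edet_const n p Qs c :
  Forall (nonempty_qset n) Qs -> edet n p Qs (fun _ => c) = c.
Proof.
  induction 1 as [|Q Qs HQ _ IH]; simpl; [reflexivity|].
  rewrite IH, rsum_scal_r, cond_prob_mass by exact HQ. lra.
Qed.

(** Answers to separate blocks of queries are independent; this makes acceptance multiplicative when
    testers are combined. *)
Lemma edet_app n p Qs1 Qs2 f g :
  edet n p (Qs1 ++ Qs2)
    (fun ans => f (firstn (length Qs1) ans) * g (skipn (length Qs1) ans)) =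
  edet n p Qs1 f * edet n p Qs2 g.
Proof.
  revert f; induction Qs1 as [|Q Qs1 IH]; intros f; simpl.
  - apply edet_scal.
  - rewrite <- rsum_scal_r. apply rsum_ext; intros i _.
    rewrite (IH (fun l => f (i :: l))). lra.
Qed.

Lemma accept_det_range n p Qs D :
  (forall i, (i < n)%nat -> 0 <= p i) -> Forall (nonempty_qset n) Qs ->
  0 <= accept_det n p Qs D <= 1.
Proof.
  intros Hp HQ. rewrite accept_det_edet. split.
  - rewrite <- (edet_const n p Qs 0 HQ) at 1. apply edet_le; auto.
    intros ans; destruct (D ans); simpl; lra.
  - rewrite <- (edet_const n p Qs 1 HQ) at 1. apply edet_le; auto.
    intros ans; destruct (D ans); simpl; lra.
Qed.

(** * Concentration of the number of heads *)

Definition heads (A : qset) (ans : list nat) : R :=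
  fold_right (fun i acc => b2R (A i) + acc) 0 ans.

(** From exp (-u) >= 1 - u one gets exp u (1 - u) <= 1, and (1 + u + 2 u^2)(1 - u) = 1 + u^2 (1 - 2
    u). All negative u are covered, which serves the lower tail. *)
Lemma exp_le_quadratic u : u <= / 2 -> exp u <= 1 + u + 2 * u ^ 2.
Proof.
  intros Hu. pose proof (exp_ineq1_le (- u)) as H. pose proof (exp_pos u).
  rewrite exp_Ropp in H.
  assert (exp u * (1 - u) <= 1).
  { apply Rmult_le_compat_l with (r := exp u) in H; [|lra].
    rewrite Rinv_r in H by lra. lra. }
  apply Rmult_le_reg_r with (1 - u); [lra|].
  assert (0 <= u ^ 2 * (1 - 2 * u)); [|nra].
  apply Rmult_le_pos; [apply pow2_ge_0|lra].
Qed.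

Lemma edet_exp_heads n p Q A k lam :
  edet n p (repeat Q k) (fun ans => exp (lam * heads A ans)) =
  rsum n (fun i => cond_prob n p Q i * exp (lam * b2R (A i))) ^ k.
Proof.
  induction k as [|k IH]; simpl; [now rewrite Rmult_0_r, exp_0|].
  rewrite <- IH, <- rsum_scal_r. apply rsum_ext; intros i _.
  rewrite Rmult_assoc, <- (edet_scal _ _ _ (exp (lam * b2R (A i)))). f_equal. apply edet_ext; intros ans.
  rewrite <- exp_plus. f_equal. lra.
Qed.

Lemma exp_INR_mult k x : exp (INR k * x) = exp x ^ k.
Proof.
  induction k as [|k IH]; [simpl; now rewrite Rmult_0_l, exp_0|].
  rewrite S_INR; simpl pow. rewrite <- IH, <- exp_plus. f_equal; lra.
Qed.

(** One toss of bias b has exponential moment 1 + b (exp lam - 1) <= 1 + lam b + 2 lam^2, using b <=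
    1; tosses are independent. *)
Lemma edet_exp_heads_le n p c k lam :
  (forall i, (i < n)%nat -> 0 <= p i) -> nonempty_qset n (fst c) -> lam <= / 2 ->
  edet n p (repeat (fst c) k) (fun ans => exp (lam * heads (snd c) ans)) <=
  exp (INR k * (lam * heads_prob n p c + 2 * lam ^ 2)).
Proof.
  intros Hp HQ Hl. rewrite edet_exp_heads, exp_INR_mult.
  pose proof (heads_prob_range n p c Hp HQ) as Hb.
  apply pow_incr. split.
  - apply rsum_nonneg; intros i Hi. apply Rmult_le_pos.
    + now apply cond_prob_nonneg.
    + left; apply exp_pos.
  - rewrite (rsum_ext n _ (fun i => cond_prob n p (fst c) i
      + (exp lam - 1) * (cond_prob n p (fst c) i * b2R (snd c i)))).
    + rewrite rsum_plus, rsum_scal, cond_prob_mass by exact HQ.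
      fold (heads_prob n p c). set (b := heads_prob n p c) in *.
      pose proof (exp_le_quadratic lam Hl) as H1.
      pose proof (exp_ineq1_le (lam * b + 2 * lam ^ 2)).
      pose proof (pow2_ge_0 lam). nra.
    + intros i _. destruct (snd c i); simpl; rewrite ?Rmult_1_r, ?Rmult_0_r, ?exp_0; lra.
Qed.

Definition far (x t : R) : bool := if Rlt_dec (Rabs x) t then false else true.

(** Chernoff bound: the indicator of a deviation is dominated by the sum of the normalised
    exponentials for the two signs of the parameter. *)
Lemma heads_deviation n p c k t :
  (forall i, (i < n)%nat -> 0 <= p i) -> nonempty_qset n (fst c) -> 0 <= t <= 1 ->
  edet n p (repeat (fst c) k)
    (fun ans => b2R (far (heads (snd c) ans - INR k * heads_prob n p c) (INR k * t / 2)))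
  <= 2 * exp (- (INR k * t ^ 2 / 32)).
Proof.
  intros Hp HQ Ht. set (b := heads_prob n p c).
  assert (HF : Forall (nonempty_qset n) (repeat (fst c) k)).
  { apply Forall_forall; intros Q HQin. now apply repeat_spec in HQin as ->. }
  (* The minimiser of 2 l^2 - l t / 2, with value - t^2 / 32. *)
  set (l := t / 8).
  set (e1 := exp (- (l * (INR k * b)) - l * (INR k * t / 2))).
  set (e2 := exp (l * (INR k * b) - l * (INR k * t / 2))).
  assert (Hexp : forall lam, lam = l \/ lam = - l ->
    edet n p (repeat (fst c) k) (fun ans => exp (lam * heads (snd c) ans))
      * exp (- (lam * (INR k * b)) - l * (INR k * t / 2))
    <= exp (- (INR k * t ^ 2 / 32))).
  { intros lam Hlam.
    eapply Rle_trans; [apply Rmult_le_compat_r; [left; apply exp_pos|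
      apply edet_exp_heads_le; auto; unfold l in *; lra]|].
    rewrite <- exp_plus. right. f_equal. fold b.
    destruct Hlam as [-> | ->]; unfold l; field. }
  pose proof (Hexp l (or_introl eq_refl)) as E1.
  pose proof (Hexp (- l) (or_intror eq_refl)) as E2.
  replace (- (- l * (INR k * b))) with (l * (INR k * b)) in E2 by ring.
  fold e1 in E1; fold e2 in E2.
  eapply Rle_trans with (edet n p (repeat (fst c) k)
    (fun ans => e1 * exp (l * heads (snd c) ans) + e2 * exp (- l * heads (snd c) ans))).
  - apply edet_le; auto. intros ans. unfold e1, e2. rewrite <- !exp_plus.
    set (h := heads (snd c) ans).
    set (x := h - INR k * b). unfold far. destruct (Rlt_dec _ _) as [_|Hx]; simpl.
    + left. apply Rplus_lt_0_compat; apply exp_pos.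
    + assert (Hl0 : 0 <= l) by (unfold l; lra).
      assert (Hone : forall y z, INR k * t / 2 <= y -> z = l * y - l * (INR k * t / 2) ->
                1 <= exp z).
      { intros y z Hy ->. pose proof (exp_ineq1_le (l * y - l * (INR k * t / 2))). nra. }
      destruct (Rcase_abs x) as [Hneg|Hpos].
      * rewrite Rabs_left in Hx by exact Hneg.
        match goal with |- _ <= exp ?u + exp ?v =>
          assert (1 <= exp v) by (apply (Hone (- x)); [lra | unfold x; ring]);
          pose proof (exp_pos u); lra end.
      * rewrite Rabs_right in Hx by exact Hpos.
        match goal with |- _ <= exp ?u + exp ?v =>
          assert (1 <= exp u) by (apply (Hone x); [lra | unfold x; ring]);
          pose proof (exp_pos v); lra end.
  - rewrite edet_plus, !edet_scal. lra.
Qed.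

(** * Combining testers *)

Definition sound_tester (n N : nat) (T : tester) : Prop :=
  supp (fun s => Forall (nonempty_qset n) (queries s) /\
                 (length (queries s) <= N)%nat) T /\ Ex T (fun _ => 1) = 1.

Lemma accept_prob_Ex n p T :
  accept_prob n p T = Ex T (fun s => accept_det n p (queries s) (decide s)).
Proof. reflexivity. Qed.

Lemma accept_prob_range n N p T :
  (forall i, (i < n)%nat -> 0 <= p i) -> sound_tester n N T ->
  0 <= accept_prob n p T <= 1.
Proof.
  intros Hp [HT H1]. rewrite accept_prob_Ex. split.
  - eapply Ex_nonneg; [exact HT|]. intros s [HQ _]. now apply accept_det_range.
  - rewrite <- H1. eapply Ex_le; [exact HT|]. intros s [HQ _]. now apply accept_det_range.
Qed.

Definition trivial_tester : tester := ret (mkStrategy [] (fun _ => true)).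

Lemma trivial_tester_sound n : sound_tester n 0 trivial_tester.
Proof. split; [apply supp_ret; simpl; auto | exact (Ex_ret _ (fun _ => 1))]. Qed.

Lemma trivial_tester_accept n p : accept_prob n p trivial_tester = 1.
Proof. rewrite accept_prob_Ex. unfold trivial_tester. now rewrite Ex_ret. Qed.

Definition strategy_and (s1 s2 : strategy) : strategy :=
  mkStrategy (queries s1 ++ queries s2)
    (fun ans => decide s1 (firstn (length (queries s1)) ans) &&
                decide s2 (skipn (length (queries s1)) ans))%bool.

Definition tester_and (T1 T2 : tester) : tester :=
  bind T1 (fun s1 => bind T2 (fun s2 => ret (strategy_and s1 s2))).

Lemma tester_and_sound n N1 N2 T1 T2 :
  sound_tester n N1 T1 -> sound_tester n N2 T2 ->
  sound_tester n (N1 + N2) (tester_and T1 T2).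
Proof.
  intros [H1 M1] [H2 M2]. split.
  - eapply supp_bind; [exact H1|]. intros s1 [Hs1 L1].
    eapply supp_bind; [exact H2|]. intros s2 [Hs2 L2].
    apply supp_ret. simpl. rewrite length_app. split; [now apply Forall_app|lia].
  - unfold tester_and. rewrite Ex_bind.
    etransitivity; [|exact M1]. apply Ex_ext; intros s1. rewrite Ex_bind.
    etransitivity; [|exact M2]. apply Ex_ext; intros s2. apply (Ex_ret _ (fun _ => 1)).
Qed.

Lemma tester_and_accept n p T1 T2 :
  accept_prob n p (tester_and T1 T2) = accept_prob n p T1 * accept_prob n p T2.
Proof.
  rewrite !accept_prob_Ex. unfold tester_and. rewrite Ex_bind, Rmult_comm, <- Ex_scal.
  apply Ex_ext; intros s1. rewrite Ex_bind, Rmult_comm, <- Ex_scal.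
  apply Ex_ext; intros s2. rewrite Ex_ret. simpl.
  rewrite !accept_det_edet, <- edet_app. apply edet_ext; intros ans.
  destruct (decide s1 _), (decide s2 _); simpl; lra.
Qed.

Fixpoint tester_pow (N : nat) (T : tester) : tester :=
  match N with O => trivial_tester | S N' => tester_and T (tester_pow N' T) end.

Lemma tester_pow_sound n K N T :
  sound_tester n K T -> sound_tester n (N * K) (tester_pow N T).
Proof.
  intros H. induction N as [|N IH]; simpl; [apply trivial_tester_sound|].
  now apply tester_and_sound.
Qed.

Lemma tester_pow_accept n p N T :
  accept_prob n p (tester_pow N T) = accept_prob n p T ^ N.
Proof.
  induction N as [|N IH]; simpl; [apply (trivial_tester_accept n p)|].
  now rewrite tester_and_accept, IH.
Qed.

(** * Testing a random coin *)

Definition valid_family (n : nat) (F : list (R * coin)) : Prop :=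
  supp (fun c => nonempty_qset n (fst c)) F /\ Ex F (fun _ => 1) = 1.

Definition coin_strategy (n : nat) (q : nat -> R) (k : nat) (t : R) (c : coin) :
  strategy :=
  mkStrategy (repeat (fst c) k)
    (fun ans => negb (far (heads (snd c) ans - INR k * heads_prob n q c) (INR k * t / 2))).

(** Each of the N rounds draws a fresh coin, so acceptance is an N-th power. The threshold k t / 2
    is half of the gap to be detected, so no frequency is close to both of two biases that differ by
    t. *)
Definition coin_tester (n : nat) (q : nat -> R) (F : list (R * coin))
    (N k : nat) (t : R) : tester :=
  tester_pow N (bind F (fun c => ret (coin_strategy n q k t c))).

Lemma coin_tester_sound n q F N k t :
  valid_family n F -> sound_tester n (N * k) (coin_tester n q F N k t).
Proof.
  intros [HF H1]. apply tester_pow_sound. split.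
  - eapply supp_bind; [exact HF|]. intros c Hc. apply supp_ret. simpl.
    rewrite repeat_length. split; [|lia].
    apply Forall_forall; intros Q HQ. now apply repeat_spec in HQ as ->.
  - rewrite Ex_bind. etransitivity; [|exact H1].
    apply Ex_ext; intros c. apply (Ex_ret _ (fun _ => 1)).
Qed.

Lemma coin_accept n p q k t c :
  nonempty_qset n (fst c) ->
  accept_det n p (queries (coin_strategy n q k t c)) (decide (coin_strategy n q k t c)) =
  1 - edet n p (repeat (fst c) k)
        (fun ans => b2R (far (heads (snd c) ans - INR k * heads_prob n q c) (INR k * t / 2))).
Proof.
  intros HQ. rewrite accept_det_edet. simpl.
  assert (HF : Forall (nonempty_qset n) (repeat (fst c) k)).
  { apply Forall_forall; intros Q HQin. now apply repeat_spec in HQin as ->. }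
  rewrite <- (edet_const n p (repeat (fst c) k) 1 HF) at 1.
  match goal with |- ?a = ?b - ?c => assert (a + c = b); [|lra] end.
  rewrite <- edet_plus. apply edet_ext; intros ans. destruct (far _ _); simpl; lra.
Qed.

Lemma Bernoulli_inequality x N : 0 <= x <= 1 -> 1 - INR N * x <= (1 - x) ^ N.
Proof.
  intros Hx. induction N as [|N IH]; [simpl; lra|].
  rewrite S_INR; simpl pow.
  assert (0 <= INR N * x) by (apply Rmult_le_pos; [apply pos_INR|lra]). nra.
Qed.

Lemma coin_tester_null n p q F N k t :
  valid_family n F -> (forall i, (i < n)%nat -> 0 <= p i) ->
  (forall i, (i < n)%nat -> p i = q i) -> 0 <= t <= 1 ->
  1 - INR N * (2 * exp (- (INR k * t ^ 2 / 32))) <=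
  accept_prob n p (coin_tester n q F N k t).
Proof.
  intros [HF H1] Hp Hpq Ht. unfold coin_tester. rewrite tester_pow_accept.
  set (e := 2 * exp (- (INR k * t ^ 2 / 32))).
  assert (He : 0 < e) by (unfold e; pose proof (exp_pos (- (INR k * t ^ 2 / 32))); lra).
  (* Bernoulli's inequality needs e <= 1. For e > 1 the claimed bound is negative, unless N = 0,
     where both sides are 1. *)
  destruct (Rlt_dec 1 e) as [Hbig|Hsmall].
  - destruct N as [|N]; [simpl; lra|].
    assert (0 <= accept_prob n p (bind F (fun c => ret (coin_strategy n q k t c)))).
    { pose proof (coin_tester_sound n q F 1 k t (conj HF H1)) as HT.
      apply (accept_prob_range n _ p _ Hp) in HT. unfold coin_tester in HT.
      rewrite tester_pow_accept in HT. simpl in HT. lra. }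
    assert (1 <= INR (S N)) by (rewrite S_INR; pose proof (pos_INR N); lra).
    apply Rle_trans with 0; [nra|]. now apply pow_le.
  - eapply Rle_trans; [apply Bernoulli_inequality; lra|].
    apply pow_incr. split; [lra|].
    rewrite accept_prob_Ex, Ex_bind.
    replace (1 - e) with (Ex F (fun _ => 1 - e)) by (rewrite Ex_const, H1; lra).
    eapply Ex_le; [exact HF|]. intros c Hc. simpl in Hc.
    rewrite Ex_ret, coin_accept by exact Hc.
    rewrite <- (heads_prob_ext n p q) by exact Hpq.
    pose proof (heads_deviation n p c k t Hp Hc Ht). fold e in H. lra.
Qed.

(** With P the probability that a random coin has a gap of at least t, each round rejects with
    probability at least P / 2, and (1 - P / 2)^N <= exp (- N P / 2). The bound on k makes a single
    coin err with probability at most 1 / 2. *)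
Lemma coin_tester_alt n p q F N k t :
  valid_family n F -> (forall i, (i < n)%nat -> 0 <= p i) -> 0 <= t <= 1 ->
  8 <= INR k * t ^ 2 / 32 ->
  accept_prob n p (coin_tester n q F N k t) <=
  exp (- (INR N * Ex F (fun c => b2R (far (heads_prob n p c - heads_prob n q c) t)) / 2)).
Proof.
  intros [HF H1] Hp Ht Hk. unfold coin_tester. rewrite tester_pow_accept.
  set (P := Ex F _).
  replace (- (INR N * P / 2)) with (INR N * (- (P / 2))) by field.
  rewrite exp_INR_mult. apply pow_incr. split.
  - pose proof (coin_tester_sound n q F 1 k t (conj HF H1)) as HT.
    apply (accept_prob_range n _ p _ Hp) in HT. unfold coin_tester in HT.
    rewrite tester_pow_accept in HT. simpl in HT. lra.
  - eapply Rle_trans; [|apply exp_ineq1_le].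
    rewrite accept_prob_Ex, Ex_bind.
    replace (1 + - (P / 2)) with
      (Ex F (fun c => 1 - / 2 * b2R (far (heads_prob n p c - heads_prob n q c) t)))
      by (rewrite Ex_minus, Ex_scal, H1; fold P; lra).
    eapply Ex_le; [exact HF|]. intros c Hc. simpl in Hc. rewrite Ex_ret.
    assert (HR : Forall (nonempty_qset n) (repeat (fst c) k)).
    { apply Forall_forall; intros Q HQin. now apply repeat_spec in HQin as ->. }
    unfold far at 1. destruct (Rlt_dec _ _) as [_|Hfar].
    + simpl. rewrite Rmult_0_r, Rminus_0_r. now apply accept_det_range.
    + (* If the observed frequency is close to the null bias, it is far from
         the true one. *)
      rewrite coin_accept by exact Hc.
      match goal with |- 1 - ?x <= _ => assert (/ 2 <= x); [|simpl; lra] end.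
      pose proof (heads_deviation n p c k t Hp Hc Ht) as Hd.
      set (f1 := fun ans => b2R (far (heads (snd c) ans - INR k * heads_prob n p c) (INR k * t / 2))) in Hd.
      set (f2 := fun ans => b2R (far (heads (snd c) ans - INR k * heads_prob n q c) (INR k * t / 2))).
      assert (1 <= edet n p (repeat (fst c) k) (fun ans => f1 ans + f2 ans)).
      { rewrite <- (edet_const n p (repeat (fst c) k) 1 HR) at 1.
        apply edet_le; auto. intros ans. unfold f1, f2, far.
        destruct (Rlt_dec _ _) as [Ha|]; destruct (Rlt_dec _ _) as [Hb|]; simpl; try lra.
        exfalso. apply Hfar.
        assert (Hk0 : 0 < INR k).
        { destruct k; [|apply lt_0_INR; lia].
          simpl in Hk. lra. }
        apply Rabs_def2 in Ha, Hb. apply Rabs_def1; nra. }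
      rewrite edet_plus in H.
      assert (2 * exp (- (INR k * t ^ 2 / 32)) <= / 2); [|lra].
      pose proof (exp_ineq1_le (INR k * t ^ 2 / 32)) as He.
      rewrite exp_Ropp.
      apply Rle_trans with (2 * / 9); [|lra]. apply Rmult_le_compat_l; [lra|].
      apply Rinv_le_contravar; lra.
Qed.

(** * Detecting a family of coins with large mean deviation *)

(* A deviation of size about 2^l / 2^J may be present in only one coin out of
   2^l, so level l examines 3 * 2^l coins with precision 2^l / 2^J; the numbers
   of tosses decrease geometrically, and the total is of order 4^J. *)
Definition level_tester (n : nat) (q : nat -> R) (F : list (R * coin)) (J l : nat) :
  tester :=
  coin_tester n q F (3 * 2 ^ l) (1024 * S l * 4 ^ (J - l)) (2 ^ l / 2 ^ J / 2).

Fixpoint mean_tester (n : nat) (q : nat -> R) (F : list (R * coin)) (J m : nat) :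
  tester :=
  match m with
  | O => trivial_tester
  | S l => tester_and (level_tester n q F J l) (mean_tester n q F J l)
  end.

Fixpoint mean_cost (J m : nat) : nat :=
  match m with
  | O => 0
  | S l => 3 * 2 ^ l * (1024 * S l * 4 ^ (J - l)) + mean_cost J l
  end.

Lemma pow2_pos k : 0 < 2 ^ k.
Proof. apply pow_lt; lra. Qed.

Lemma pow4 k : 4 ^ k = (2 ^ k) ^ 2.
Proof. rewrite <- pow_mult, Nat.mul_comm, pow_mult. f_equal; lra. Qed.

Lemma level_precision J l :
  (l <= J)%nat -> 0 <= 2 ^ l / 2 ^ J / 2 <= 1.
Proof.
  intros Hl. pose proof (pow2_pos l). pose proof (pow2_pos J).
  assert (2 ^ l <= 2 ^ J) by (apply Rle_pow; [lra|lia]).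
  assert (0 < 2 ^ l / 2 ^ J) by (apply Rdiv_lt_0_compat; lra).
  assert (2 ^ l / 2 ^ J <= 1); [|lra].
  apply Rmult_le_reg_r with (2 ^ J); [lra|]. unfold Rdiv.
  rewrite Rmult_assoc, Rinv_l by lra. lra.
Qed.

(** Explains 1024 = 8 . 32 . 4. The factor [S l] in the number of tosses makes the error per coin,
    exp (-8 (l + 1)), beat the 3 . 2^l coins of the level. *)
Lemma level_exponent J l :
  (l <= J)%nat ->
  INR (1024 * S l * 4 ^ (J - l)) * (2 ^ l / 2 ^ J / 2) ^ 2 / 32 = 8 * INR (S l).
Proof.
  intros Hl. rewrite !mult_INR, pow_INR.
  replace (INR 1024) with 1024 by (rewrite INR_IZR_INZ; reflexivity).
  replace (INR 4) with 4 by (simpl; lra).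
  assert (H : 4 ^ J = 4 ^ (J - l) * 4 ^ l) by (rewrite <- pow_add; f_equal; lia).
  rewrite (pow4 J), (pow4 l) in H.
  pose proof (pow2_pos J). pose proof (pow2_pos l).
  replace (1024 * INR (S l) * 4 ^ (J - l) * (2 ^ l / 2 ^ J / 2) ^ 2 / 32)
    with (8 * INR (S l) * (4 ^ (J - l) * (2 ^ l) ^ 2) / (2 ^ J) ^ 2) by (field; lra).
  rewrite <- H. field. lra.
Qed.

Lemma exp_neg_8_mult_le k : exp (- (8 * INR k)) <= (/ 256) ^ k.
Proof.
  replace (- (8 * INR k)) with (INR k * - (8 * 1)) by ring.
  rewrite exp_INR_mult. apply pow_incr. split; [left; apply exp_pos|].
  rewrite exp_Ropp. apply Rinv_le_contravar; [lra|].
  replace 8 with (INR 8) by (simpl; lra). rewrite exp_INR_mult.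
  pose proof (exp_ineq1_le 1).
  apply Rle_trans with (2 ^ 8); [lra|]. apply pow_incr; lra.
Qed.

Lemma mean_tester_sound n q F J m :
  valid_family n F -> sound_tester n (mean_cost J m) (mean_tester n q F J m).
Proof.
  intros HF. induction m as [|m IH]; [apply trivial_tester_sound|].
  apply tester_and_sound; [|exact IH]. now apply coin_tester_sound.
Qed.

(** Level l costs 3072 . 4^J (l + 1) / 2^l, and the sum of (l + 1) / 2^l over l < m is 4 - 2 (m + 2)
    / 2^m. *)
Lemma mean_cost_le J : INR (mean_cost J (S J)) <= 12288 * 4 ^ J.
Proof.
  assert (H : forall m, (m <= S J)%nat ->
    INR (mean_cost J m) = 3072 * 4 ^ J * (4 - 2 * (INR m + 2) / 2 ^ m)).
  { induction m as [|m IH]; intros Hm; [simpl; field|].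
    change (mean_cost J (S m))
      with (3 * 2 ^ m * (1024 * S m * 4 ^ (J - m)) + mean_cost J m)%nat.
    rewrite plus_INR, IH by lia. rewrite !mult_INR, !pow_INR.
    replace (INR 1024) with 1024 by (rewrite INR_IZR_INZ; reflexivity).
    replace (INR 4) with 4 by (simpl; lra). replace (INR 3) with 3 by (simpl; lra).
    replace (INR 2) with 2 by (simpl; lra).
    assert (E : 4 ^ J = 4 ^ (J - m) * 4 ^ m) by (rewrite <- pow_add; f_equal; lia).
    rewrite (pow4 m) in E. rewrite E, S_INR. simpl pow.
    pose proof (pow2_pos m). field. lra. }
  rewrite H by lia.
  assert (0 < 4 ^ J) by (apply pow_lt; lra).
  assert (0 <= 2 * (INR (S J) + 2) / 2 ^ S J); [|nra].
  apply Rle_mult_inv_pos; [pose proof (pos_INR (S J)); lra | apply pow2_pos].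
Qed.

Lemma mean_tester_null n p q F J :
  valid_family n F -> (forall i, (i < n)%nat -> 0 <= p i) ->
  (forall i, (i < n)%nat -> p i = q i) ->
  1 - 12 / 256 <= accept_prob n p (mean_tester n q F J (S J)).
Proof.
  intros HF Hp Hpq.
  assert (H : forall m, (m <= S J)%nat ->
    1 - 12 / 256 * (1 - (/ 2) ^ m) <= accept_prob n p (mean_tester n q F J m)).
  { induction m as [|m IH]; intros Hm; [simpl mean_tester; rewrite trivial_tester_accept; simpl; lra|].
    simpl mean_tester. rewrite tester_and_accept.
    specialize (IH ltac:(lia)).
    pose proof (coin_tester_null n p q F (3 * 2 ^ m) (1024 * S m * 4 ^ (J - m))
                  (2 ^ m / 2 ^ J / 2) HF Hp Hpq (level_precision J m ltac:(lia))) as HL.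
    fold (level_tester n q F J m) in HL. rewrite level_exponent in HL by lia.
    pose proof (accept_prob_range n _ p _ Hp
      (coin_tester_sound n q F (3 * 2 ^ m) (1024 * S m * 4 ^ (J - m)) (2 ^ m / 2 ^ J / 2) HF)) as R1.
    fold (level_tester n q F J m) in R1.
    pose proof (accept_prob_range n _ p _ Hp (mean_tester_sound n q F J m HF)) as R2.
    (* Level m errs with probability at most 6 . 2^m / 256^(m + 1), so the errors are dominated by a
       geometric series of sum 12 / 256. *)
    assert (E : INR (3 * 2 ^ m) * (2 * exp (- (8 * INR (S m)))) <= 6 / 256 * (/ 2) ^ m).
    { rewrite mult_INR, pow_INR. replace (INR 3) with 3 by (simpl; lra).
      replace (INR 2) with 2 by (simpl; lra).
      pose proof (exp_neg_8_mult_le (S m)) as He. simpl pow in He.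
      pose proof (pow2_pos m).
      apply Rle_trans with (6 * 2 ^ m * (/ 256 * (/ 256) ^ m)); [nra|].
      assert (2 ^ m * (/ 256) ^ m <= (/ 2) ^ m); [|lra].
      rewrite <- Rpow_mult_distr. apply pow_incr; lra. }
    simpl pow. nra. }
  specialize (H (S J) (le_n _)).
  assert (0 < (/ 2) ^ S J) by (apply pow_lt; lra). lra.
Qed.

(** A dyadic layer-cake bound: if y passes exactly the levels below k, with k < m, the sum is 2^k -
    1 and y / u < 2^k. *)
Lemma dyadic_layers y u m :
  0 < u -> 0 <= y ->
  Rmin (y / u) (2 ^ m) - 1 <= rsum m (fun l => 2 ^ l * b2R (far y (2 ^ l * u))).
Proof.
  intros Hu Hy. induction m as [|m IH]; [simpl; pose proof (Rmin_r (y / u) 1); lra|].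
  rewrite rsum_S. pose proof (pow2_pos m). unfold far at 2. rewrite Rabs_right by lra.
  assert (Hyu : y = y / u * u) by (field; lra).
  destruct (Rlt_dec _ _) as [Hlt|Hge]; simpl b2R; simpl pow.
  - assert (y / u < 2 ^ m) by nra. rewrite Rmin_left in * by lra. lra.
  - assert (2 ^ m <= y / u) by nra. rewrite (Rmin_right (y / u) (2 ^ m)) in IH by lra.
    pose proof (Rmin_r (y / u) (2 * 2 ^ m)). lra.
Qed.

Lemma exp_le_compat x y : x <= y -> exp x <= exp y.
Proof.
  intros [H|H]; [left; now apply exp_increasing | right; now rewrite H].
Qed.

Lemma exp_neg_three_halves : exp (- (3 / 2)) <= 1 / 3.
Proof.
  rewrite exp_Ropp. replace (1 / 3) with (/ 3) by lra. apply Rinv_le_contravar; [lra|].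
  replace (3 / 2) with (INR 2 * (3 / 4)) by (simpl; lra). rewrite exp_INR_mult.
  pose proof (exp_ineq1_le (3 / 4)). nra.
Qed.

Lemma far_Rabs x t : far (Rabs x) t = far x t.
Proof. unfold far. now rewrite Rabs_Rabsolu. Qed.

(** No single level has to succeed alone. If P_l is the probability of a gap of at least 2^l / 2^J /
    2, level l contributes 3/2 . 2^l P_l to the exponent, and by [dyadic_layers] the sum of 2^l P_l
    is at least 2 . 2^J E|y| - 1 >= 1. *)
Lemma mean_tester_alt n p q F J :
  valid_family n F -> (forall i, (i < n)%nat -> 0 <= p i) ->
  (forall i, (i < n)%nat -> 0 <= q i) ->
  / 2 ^ J <= Ex F (fun c => Rabs (heads_prob n p c - heads_prob n q c)) ->
  accept_prob n p (mean_tester n q F J (S J)) <= 1 / 3.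
Proof.
  intros HF Hp Hq HE. set (y := fun c => heads_prob n p c - heads_prob n q c) in *.
  assert (H : forall m, (m <= S J)%nat ->
    accept_prob n p (mean_tester n q F J m) <=
    exp (- (3 / 2 * rsum m (fun l => 2 ^ l * Ex F (fun c => b2R (far (y c) (2 ^ l / 2 ^ J / 2))))))).
  { induction m as [|m IH]; intros Hm.
    - simpl mean_tester. rewrite trivial_tester_accept. simpl. rewrite Rmult_0_r, Ropp_0, exp_0; lra.
    - simpl mean_tester. rewrite tester_and_accept, rsum_S.
      specialize (IH ltac:(lia)).
      assert (HL := coin_tester_alt n p q F (3 * 2 ^ m) (1024 * S m * 4 ^ (J - m))
                    (2 ^ m / 2 ^ J / 2) HF Hp (level_precision J m ltac:(lia))).
      rewrite level_exponent in HL by lia. fold (level_tester n q F J m) in HL.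
      specialize (HL ltac:(rewrite S_INR; pose proof (pos_INR m); lra)).
      pose proof (accept_prob_range n _ p _ Hp
        (coin_tester_sound n q F (3 * 2 ^ m) (1024 * S m * 4 ^ (J - m)) (2 ^ m / 2 ^ J / 2) HF)) as R1.
      fold (level_tester n q F J m) in R1.
      pose proof (accept_prob_range n _ p _ Hp (mean_tester_sound n q F J m HF)) as R2.
      eapply Rle_trans; [apply Rmult_le_compat; [apply R1|apply R2|exact HL|exact IH]|].
      rewrite <- exp_plus. right. f_equal.
      rewrite mult_INR, pow_INR. replace (INR 3) with 3 by (simpl; lra).
      replace (INR 2) with 2 by (simpl; lra). unfold y. field. }
  eapply Rle_trans; [apply H; apply le_n|].
  eapply Rle_trans; [|apply exp_neg_three_halves].
  match goal with |- exp (- (3 / 2 * ?s)) <= _ => assert (1 <= s) end.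
  2:{ apply exp_le_compat; lra. }
  rewrite (rsum_ext _ _ (fun l => Ex F (fun c => 2 ^ l * b2R (far (y c) (2 ^ l / 2 ^ J / 2)))))
    by (intros; now rewrite Ex_scal).
  rewrite <- (Ex_rsum F (S J) (fun c l => 2 ^ l * b2R (far (y c) (2 ^ l / 2 ^ J / 2)))).
  destruct HF as [HF H1]. pose proof (pow2_pos J).
  apply Rle_trans with (Ex F (fun c => 2 * 2 ^ J * Rabs (y c) - 1)).
  - rewrite Ex_minus, Ex_scal, H1.
    change (/ 2 ^ J <= Ex F (fun c => Rabs (y c))) in HE. apply Rmult_le_compat_l with (r := 2 ^ J) in HE; [|lra].
    rewrite Rinv_r in HE by lra. lra.
  - eapply Ex_le; [exact HF|]. intros c Hc. simpl in Hc.
    pose proof (heads_prob_range n p c Hp Hc). pose proof (heads_prob_range n q c Hq Hc).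
    assert (Rabs (y c) <= 1) by (unfold y; apply Rabs_le; lra).
    assert (Hu : 0 < / (2 * 2 ^ J)) by (apply Rinv_0_lt_compat; lra).
    eapply Rle_trans; [|right; apply rsum_ext; intros l _; rewrite <- far_Rabs;
      replace (2 ^ l / 2 ^ J / 2) with (2 ^ l * / (2 * 2 ^ J)) by (field; lra); reflexivity].
    eapply Rle_trans; [|apply dyadic_layers; [exact Hu|apply Rabs_pos]].
    replace (Rabs (y c) / / (2 * 2 ^ J)) with (2 * 2 ^ J * Rabs (y c)) by (field; lra).
    (* The cap 2^(J + 1) is inactive because |y| <= 1; this is why J + 1 levels are run. *)
    rewrite Rmin_left; [lra|]. simpl pow. nra.
Qed.

(** * Dyadic buckets *)

Lemma massS_ext n f g S :
  (forall i, (i < n)%nat -> S i = true -> f i = g i) -> massS n f S = massS n g S.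
Proof.
  intros H. apply rsum_ext; intros i Hi. specialize (H i Hi). destruct (S i); auto.
Qed.

Lemma massS_le n f g S :
  (forall i, (i < n)%nat -> S i = true -> f i <= g i) -> massS n f S <= massS n g S.
Proof.
  intros H. apply rsum_le; intros i Hi. specialize (H i Hi). destruct (S i); [auto|lra].
Qed.

Lemma massS_plus n f g S :
  massS n (fun i => f i + g i) S = massS n f S + massS n g S.
Proof. unfold massS. rewrite <- rsum_plus. apply rsum_ext; intros i _. destruct (S i); lra. Qed.

Lemma massS_minus n f g S :
  massS n (fun i => f i - g i) S = massS n f S - massS n g S.
Proof. unfold massS. rewrite <- rsum_minus. apply rsum_ext; intros i _. destruct (S i); lra. Qed.

Lemma massS_scal n c f S : massS n (fun i => c * f i) S = c * massS n f S.
Proof. unfold massS. rewrite <- rsum_scal. apply rsum_ext; intros i _. destruct (S i); lra. Qed.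

Lemma massS_term_le n p S i :
  (forall j, (j < n)%nat -> 0 <= p j) -> (i < n)%nat -> S i = true -> p i <= massS n p S.
Proof.
  intros Hp Hi HS. replace (p i) with (if S i then p i else 0) by now rewrite HS.
  apply (rsum_term_le n i (fun j => if S j then p j else 0)); [|exact Hi].
  intros j Hj. destruct (S j); [auto|lra].
Qed.

(** For x <= 1, level k < m is the range (2^-(k+1), 2^-k]; level m collects everything up to 2^-m,
    zero included, and so has no lower bound. *)
Fixpoint level_of (x : R) (m : nat) : nat :=
  match m with
  | O => O
  | S j => if Rle_dec x (/ 2 ^ S j) then S j else level_of x j
  end.

Lemma level_of_le x m : (level_of x m <= m)%nat.
Proof. induction m as [|m IH]; [simpl; lia|]. cbn [level_of]. destruct (Rle_dec _ _); lia. Qed.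

Lemma level_of_upper x m : x <= 1 -> x <= / 2 ^ level_of x m.
Proof.
  intros Hx. induction m as [|m IH]; [simpl; lra|]. cbn [level_of].
  destruct (Rle_dec _ _); auto.
Qed.

Lemma level_of_lower x m :
  (level_of x m < m)%nat -> / 2 ^ S (level_of x m) < x.
Proof.
  induction m as [|m IH]; intros H; [simpl in H; lia|]. cbn [level_of] in *.
  destruct (Rle_dec x (/ 2 ^ S m)) as [|Hx]; [lia|].
  destruct (Nat.eq_dec (level_of x m) m) as [E|E].
  - rewrite E. lra.
  - apply IH. pose proof (level_of_le x m). lia.
Qed.

Definition bucket (q : nat -> R) (m k : nat) : qset :=
  fun i => (level_of (q i) m =? k)%nat.

Lemma massS_buckets n q m f :
  rsum (S m) (fun k => massS n f (bucket q m k)) = rsum n f.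
Proof.
  unfold massS, bucket. rewrite rsum_swap. apply rsum_ext; intros i _.
  apply rsum_delta. pose proof (level_of_le (q i) m). lia.
Qed.

(** * Random unions of buckets *)

Definition coarse_family (q : nat -> R) (m : nat) : list (R * coin) :=
  bind (prodm true signs (S m))
    (fun g => ret ((fun _ => true), (fun i => g (level_of (q i) m)))).

Lemma coarse_family_valid n q m : (1 <= n)%nat -> valid_family n (coarse_family q m).
Proof.
  intros Hn. split.
  - eapply supp_bind; [apply supp_prodm, supp_signs|]. intros g _.
    apply supp_ret. exists O. split; [lia|reflexivity].
  - unfold coarse_family. rewrite Ex_bind.
    rewrite (Ex_ext _ _ (fun _ => 1)) by (intros; apply (Ex_ret _ (fun _ => 1))).
    apply prodm_mass, signs_mass.
Qed.

Lemma heads_prob_all n p A :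
  is_dist n p -> heads_prob n p ((fun _ => true), A) = rsum n (fun i => p i * b2R (A i)).
Proof.
  intros [_ H1].
  assert (HM : massS n p (fun _ => true) = 1) by exact H1.
  rewrite heads_prob_ratio by (rewrite HM; lra). rewrite HM.
  unfold massS, Rdiv. rewrite Rinv_1, Rmult_1_r. apply rsum_ext; intros i _.
  simpl. destruct (A i); simpl; lra.
Qed.

(** The bucket differences x_k sum to 0, so a random union deviates by half of a random signed sum
    of the x_k. Khintchine gives 3/10 of the l2 norm of x, which by Cauchy-Schwarz is at least the
    l1 norm over sqrt (m + 1). *)
Lemma coarse_deviation n p q m e :
  is_dist n p -> is_dist n q -> 0 < e ->
  e <= rsum (S m) (fun k => Rabs (massS n p (bucket q m k) - massS n q (bucket q m k))) ->
  3 / 20 * (e / sqrt (INR (S m))) <=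
  Ex (coarse_family q m) (fun c => Rabs (heads_prob n p c - heads_prob n q c)).
Proof.
  intros Hp Hq He Hx.
  set (x := fun k => massS n p (bucket q m k) - massS n q (bucket q m k)) in *.
  change (e <= rsum (S m) (fun k => Rabs (x k))) in Hx.
  unfold coarse_family. rewrite Ex_bind.
  assert (Hx0 : rsum (S m) x = 0).
  { unfold x. rewrite rsum_minus, !massS_buckets. destruct Hp as [_ ->], Hq as [_ ->]. lra. }
  rewrite (Ex_ext _ _ (fun g => / 2 * Rabs (rsum (S m) (fun k => x k * sgn (g k))))).
  2:{ intros g. rewrite Ex_ret, !heads_prob_all, <- rsum_minus by assumption.
      rewrite <- (massS_buckets n q m).
      rewrite <- (Rabs_right (/ 2)) at 1 by lra. rewrite <- Rabs_mult. f_equal.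
      rewrite <- rsum_scal.
      replace (rsum (S m) (fun i => / 2 * (x i * sgn (g i))))
        with (rsum (S m) (fun i => / 2 * x i) + rsum (S m) (fun i => / 2 * (x i * sgn (g i))))
        by (rewrite (rsum_scal _ _ x), Hx0; lra).
      rewrite <- rsum_plus. apply rsum_ext; intros k _.
      rewrite (massS_ext n _ (fun i => b2R (g k) * (p i - q i))).
      - rewrite massS_scal, massS_minus. fold (x k). destruct (g k); simpl; lra.
      - intros i _ Hi. unfold bucket in Hi. apply Nat.eqb_eq in Hi as ->. ring. }
  rewrite Ex_scal.
  set (s2 := rsum (S m) (fun k => x k ^ 2)).
  assert (HCS := rsum_Cauchy_Schwarz (S m) (fun k => Rabs (x k)) (fun _ => 1)).
  rewrite (rsum_ext _ (fun k => Rabs (x k) * 1) (fun k => Rabs (x k))) in HCS by (intros; lra).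
  rewrite (rsum_ext _ (fun k => Rabs (x k) ^ 2) (fun k => x k ^ 2)) in HCS
    by (intros; apply pow2_abs).
  rewrite (rsum_const (S m) (1 ^ 2)) in HCS. fold s2 in HCS.
  set (K := INR (S m)) in *.
  assert (HK : 0 < K) by (apply lt_0_INR; lia).
  assert (HsK : 0 < sqrt K) by now apply sqrt_lt_R0.
  assert (HKK : sqrt K * sqrt K = K) by (apply sqrt_sqrt; lra).
  assert (Hs2 : 0 < s2) by nra.
  assert (Hs : 0 < sqrt s2) by now apply sqrt_lt_R0.
  assert (Hss : sqrt s2 * sqrt s2 = s2) by (apply sqrt_sqrt; lra).
  assert (HKh := Khintchine_L1 (S m) x (sqrt s2) Hs ltac:(fold s2; simpl; lra)).
  assert (e / sqrt K <= sqrt s2); [|lra].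
  apply Rmult_le_reg_r with (sqrt K); [exact HsK|].
  replace (e / sqrt K * sqrt K) with e by (field; lra).
  apply Rsqr_incr_0_var; [unfold Rsqr; nra | nra].
Qed.

(** * Pairs of elements of a bucket *)

Definition pair_coin (i j : nat) : coin :=
  ((fun x => (i =? x) || (j =? x))%nat%bool, (fun x => i =? x)%nat).

Definition pair_family (n : nat) (q : nat -> R) (m : nat) : list (R * coin) :=
  bind (weights n q) (fun i =>
    bind (weights n (cond_prob n q (bucket q m (level_of (q i) m))))
      (fun j => ret (pair_coin i j))).

Lemma bucket_self q m i : bucket q m (level_of (q i) m) i = true.
Proof. apply Nat.eqb_refl. Qed.

Lemma pair_family_valid n q m : is_dist n q -> valid_family n (pair_family n q m).
Proof.
  intros [Hq H1]. split.
  - eapply supp_bind; [apply supp_weights, Hq|]. intros i Hi.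
    assert (HB : nonempty_qset n (bucket q m (level_of (q i) m)))
      by (exists i; split; [exact Hi|apply bucket_self]).
    eapply supp_bind.
    + apply supp_weights. intros j Hj. now apply cond_prob_nonneg.
    + intros j _. apply supp_ret. exists i. split; [exact Hi|]. simpl.
      now rewrite Nat.eqb_refl.
  - unfold pair_family. rewrite Ex_bind, Ex_weights.
    etransitivity; [|exact H1]. apply rsum_ext; intros i Hi.
    assert (HB : nonempty_qset n (bucket q m (level_of (q i) m)))
      by (exists i; split; [exact Hi|apply bucket_self]).
    rewrite Ex_bind, Ex_weights.
    rewrite (rsum_ext n _ (cond_prob n q (bucket q m (level_of (q i) m)))).
    + rewrite cond_prob_mass by exact HB. lra.
    + intros j _. rewrite (Ex_ret _ (fun _ => 1)). lra.
Qed.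

Lemma heads_prob_pair n p i j :
  (i < n)%nat -> (j < n)%nat -> i <> j -> p i + p j <> 0 ->
  heads_prob n p (pair_coin i j) = p i / (p i + p j).
Proof.
  intros Hi Hj Hij H0. unfold pair_coin.
  assert (HM : massS n p (fun x => (i =? x) || (j =? x))%nat%bool = p i + p j).
  { rewrite <- (rsum_delta n i (p i)), <- (rsum_delta n j (p j)) by assumption.
    rewrite <- rsum_plus. apply rsum_ext; intros x _.
    destruct (Nat.eqb_spec i x), (Nat.eqb_spec j x); subst; simpl; try lra. congruence. }
  rewrite heads_prob_ratio; rewrite HM; [|exact H0]. f_equal.
  rewrite <- (rsum_delta n i (p i)) by assumption. apply rsum_ext; intros x _.
  destruct (Nat.eqb_spec i x), (Nat.eqb_spec j x); subst; reflexivity.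
Qed.

(** A pair coin sees only |a - b| / (a + b), which fades when both ratios are large; truncation at
    100 makes it control an absolute difference. If exactly one argument exceeds 100, the inequality
    reduces to (100 - y)^2 >= 0 at x = 100. *)
Lemma truncated_ratio_diff a b :
  0 <= a -> 0 <= b -> 0 < a + b ->
  Rabs (Rmin a 100 - Rmin b 100) * (a + b) <= 200 * Rabs (a - b).
Proof.
  assert (H : forall x y, 0 <= y <= x ->
    (Rmin x 100 - Rmin y 100) * (x + y) <= 200 * (x - y)).
  { intros x y Hxy. destruct (Rle_dec x 100) as [Hx|Hx].
    - rewrite !Rmin_left by lra. nra.
    - rewrite (Rmin_right x) by lra. destruct (Rle_dec y 100) as [Hy|Hy].
      + rewrite Rmin_left by lra. nra.
      + rewrite Rmin_right by lra. lra. }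
  intros Ha Hb Hab. destruct (Rle_dec b a) as [Hba|Hba].
  - rewrite (Rabs_right (a - b)) by lra.
    rewrite Rabs_right; [now apply H|].
    apply Rge_minus, Rle_ge, Rle_min_compat_r; lra.
  - rewrite (Rabs_minus_sym a b), (Rabs_right (b - a)), Rabs_minus_sym by lra.
    rewrite Rabs_right; [rewrite (Rplus_comm a b); apply H; lra|].
    apply Rge_minus, Rle_ge, Rle_min_compat_r; lra.
Qed.

(** In terms of the ratios a, b the gap of the coin is q_i q_j |a - b| / ((q_i + q_j)(a q_i + b
    q_j)). Inside a bucket this is at least |a - b| / (8 (a + b)), and [truncated_ratio_diff] costs
    another 200. *)
Lemma pair_deviation n p q i j theta c :
  (i < n)%nat -> (j < n)%nat -> 0 <= p i -> 0 <= p j -> 0 < theta -> 0 < c ->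
  theta / 2 <= q i <= theta -> theta / 2 <= q j <= theta ->
  / 1600 * Rabs (Rmin (c * p i / q i) 100 - Rmin (c * p j / q j) 100) <=
  Rabs (heads_prob n p (pair_coin i j) - heads_prob n q (pair_coin i j)).
Proof.
  intros Hi Hj Hpi Hpj Ht Hc Hqi Hqj.
  set (a := c * p i / q i). set (b := c * p j / q j).
  assert (Ha : 0 <= a) by (apply Rle_mult_inv_pos; [nra|lra]).
  assert (Hb : 0 <= b) by (apply Rle_mult_inv_pos; [nra|lra]).
  destruct (Nat.eq_dec i j) as [->|Hij].
  { fold b in a. unfold a. rewrite Rminus_diag, Rabs_R0, Rmult_0_r. apply Rabs_pos. }
  (* When p vanishes on the pair the oracle answers uniformly and the ratio formula fails, but then
     a = b = 0. *)
  destruct (Req_dec (p i + p j) 0) as [H0|H0].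
  { assert (Ea : a = 0) by (unfold a; replace (p i) with 0 by lra; unfold Rdiv; ring).
    assert (Eb : b = 0) by (unfold b; replace (p j) with 0 by lra; unfold Rdiv; ring).
    rewrite Ea, Eb, Rminus_diag, Rabs_R0, Rmult_0_r. apply Rabs_pos. }
  rewrite !heads_prob_pair by (assumption || lra).
  assert (Epi : p i = a * q i / c) by (unfold a; field; lra).
  assert (Epj : p j = b * q j / c) by (unfold b; field; lra).
  assert (Hsum : 0 < a * q i + b * q j).
  { assert (E : a * q i + b * q j = c * (p i + p j)) by (unfold a, b; field; lra).
    rewrite E. apply Rmult_lt_0_compat; lra. }
  assert (Hab : 0 < a + b) by nra.
  replace (p i / (p i + p j) - q i / (q i + q j))
    with (q i * q j * (a - b) / ((q i + q j) * (a * q i + b * q j)))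
    by (rewrite Epi, Epj; field; repeat split; lra).
  unfold Rdiv at 1. rewrite !Rabs_mult, Rabs_inv.
  rewrite (Rabs_right (q i)), (Rabs_right (q j)) by lra.
  rewrite (Rabs_right ((q i + q j) * (a * q i + b * q j))) by nra.
  pose proof (truncated_ratio_diff a b Ha Hb Hab) as HT.
  set (d := Rabs (a - b)) in *. assert (0 <= d) by apply Rabs_pos.
  set (e := Rabs (Rmin a 100 - Rmin b 100)) in *. assert (0 <= e) by apply Rabs_pos.
  assert (HD : 0 < (q i + q j) * (a * q i + b * q j)) by nra.
  apply Rmult_le_reg_r with ((q i + q j) * (a * q i + b * q j)); [exact HD|].
  rewrite (Rmult_assoc (q i * q j * d)), Rinv_l, Rmult_1_r by lra.
  assert (Hden : (q i + q j) * (a * q i + b * q j) <= 2 * theta * (theta * (a + b))).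
  { apply Rmult_le_compat; nra. }
  assert (Hnum : theta * theta / 4 <= q i * q j) by nra.
  apply Rle_trans with (/ 1600 * e * (2 * theta * (theta * (a + b)))).
  - apply Rmult_le_compat_l; lra.
  - apply Rle_trans with (theta * theta / 4 * d); [|apply Rmult_le_compat_r; lra].
    replace (/ 1600 * e * (2 * theta * (theta * (a + b))))
      with (theta * theta / 800 * (e * (a + b))) by field.
    replace (theta * theta / 4 * d) with (theta * theta / 800 * (200 * d)) by field.
    apply Rmult_le_compat_l; [|exact HT]. nra.
Qed.

(* With c the ratio of the masses of the bucket under q and p, [c * p i] is the
   value at i of p rescaled to have the mass of q there. *)
Definition heavy_part (c : R) (p q : nat -> R) (i : nat) : R :=
  if Rlt_dec (100 * q i) (c * p i) then c * p i else 0.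

(** Let f be the truncated ratio. Truncation loses at most the heavy mass, so the q-mean of f over S
    is at least 1 - mu / W. Where c p_i < q_i, the mean of |f_i - f_j| over j is at least this mean
    minus f_i. Since c p and q have equal mass on S, the deficits of c p below q add up to half of
    the l1 distance. *)
Lemma bucket_pairs n p q S theta c :
  (forall i, (i < n)%nat -> 0 <= p i) -> 0 < theta -> 0 < c ->
  (forall i, (i < n)%nat -> S i = true -> theta / 2 <= q i <= theta) ->
  0 < massS n q S -> c * massS n p S = massS n q S ->
  / 1600 * (/ 2 * massS n (fun i => Rabs (c * p i - q i)) S
            - massS n (heavy_part c p q) S) <=
  massS n (fun i => q i * massS n (fun j => q j / massS n q S *
    Rabs (heads_prob n p (pair_coin i j) - heads_prob n q (pair_coin i j))) S) S.
Proof.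
  intros Hp Ht Hc Hq HW Hmass. set (W := massS n q S) in *.
  set (f := fun i => Rmin (c * p i / q i) 100).
  set (mu := massS n (heavy_part c p q) S).
  assert (Hf : 1 - mu / W <= massS n (fun j => q j / W * f j) S).
  { apply Rmult_le_reg_l with W; [exact HW|].
    rewrite <- massS_scal. replace (W * (1 - mu / W)) with (W - mu) by (field; lra).
    rewrite <- Hmass at 1. unfold mu. rewrite <- massS_scal, <- massS_minus.
    apply massS_le; intros i Hi HS. specialize (Hq i Hi HS).
    replace (W * (q i / W * f i)) with (q i * f i) by (field; lra).
    unfold heavy_part, f. specialize (Hp i Hi).
    destruct (Rlt_dec _ _) as [Hlt|Hle].
    - rewrite Rminus_diag. apply Rmult_le_pos; [lra|].
      apply Rmin_glb; [apply Rle_mult_inv_pos; nra|lra].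
    - rewrite Rmin_left; [right; field; lra|].
      apply Rmult_le_reg_r with (q i); [lra|].
      replace (c * p i / q i * q i) with (c * p i) by (field; lra). lra. }
  (* The two halves add up to the positive part of q_i - c p_i. *)
  assert (Hterm : forall i, (i < n)%nat -> S i = true ->
    (/ 2 * Rabs (c * p i - q i) + / 2 * (q i - c * p i)) - mu / W * q i <=
    q i * massS n (fun j => q j / W * Rabs (f i - f j)) S).
  { intros i Hi HS. pose proof (Hq i Hi HS) as Hqi.
    assert (HA : 0 <= massS n (fun j => q j / W * Rabs (f i - f j)) S).
    { apply rsum_nonneg; intros j Hj. specialize (Hq j Hj). destruct (S j); [|lra].
      specialize (Hq eq_refl).
      apply Rmult_le_pos; [apply Rle_mult_inv_pos; lra|apply Rabs_pos]. }
    assert (HBd : massS n (fun j => q j / W * f j) S - f i <=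
                 massS n (fun j => q j / W * Rabs (f i - f j)) S).
    { replace (f i) with (massS n (fun j => q j / W * f i) S) at 1.
      - rewrite <- massS_minus. apply massS_le; intros j Hj HSj.
        specialize (Hq j Hj HSj). rewrite <- Rmult_minus_distr_l.
        apply Rmult_le_compat_l; [apply Rle_mult_inv_pos; lra|].
        rewrite Rabs_minus_sym. apply Rle_abs.
      - rewrite (massS_ext n _ (fun j => (f i / W) * q j)) by (intros; unfold Rdiv; ring).
        rewrite massS_scal. fold W. field; lra. }
    assert (Hmu : 0 <= mu).
    { apply rsum_nonneg; intros j Hj. destruct (S j); [|lra]. unfold heavy_part.
      specialize (Hp j Hj). destruct (Rlt_dec _ _); nra. }
    assert (0 <= mu / W) by (apply Rle_mult_inv_pos; lra).
    assert (Hfi : q i * f i <= c * p i).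
    { unfold f. replace (c * p i) with (q i * (c * p i / q i)) at 2 by (field; lra).
      apply Rmult_le_compat_l; [lra|apply Rmin_l]. }
    destruct (Rle_dec (c * p i) (q i)) as [Hle|Hgt].
    - rewrite Rabs_left1 by lra. nra.
    - rewrite Rabs_right by lra. nra. }
  apply Rle_trans with
    (/ 1600 * massS n (fun i => q i * massS n (fun j => q j / W * Rabs (f i - f j)) S) S).
  - apply Rmult_le_compat_l; [lra|].
    eapply Rle_trans; [|apply massS_le; exact Hterm].
    rewrite massS_minus, massS_plus, !massS_scal, massS_minus, massS_scal.
    fold W. rewrite Hmass. right. field. lra.
  - rewrite <- massS_scal. apply massS_le; intros i Hi HSi.
    rewrite <- Rmult_assoc, (Rmult_comm (/ 1600)), Rmult_assoc.
    pose proof (Hq i Hi HSi). apply Rmult_le_compat_l; [lra|].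
    rewrite <- massS_scal. apply massS_le; intros j Hj HSj.
    pose proof (Hq j Hj HSj).
    rewrite <- Rmult_assoc, (Rmult_comm (/ 1600)), Rmult_assoc.
    apply Rmult_le_compat_l; [apply Rle_mult_inv_pos; lra|].
    apply pair_deviation with theta; auto.
Qed.

(** * Random splits of a sparse random subset of a bucket *)

(** [None] leaves an element out of the random subset; [Some b] keeps it, on a fair random side
    b. *)
Definition tri (rho : R) : list (R * option bool) :=
  [(1 - rho, None); (rho / 2, Some true); (rho / 2, Some false)].

Definition chosen (o : option bool) : bool := match o with Some _ => true | None => false end.

Definition left_side (o : option bool) : bool :=
  match o with Some true => true | _ => false end.

(* The whole domain replaces an empty random subset, which cannot be queried. *)
Definition split_coin (n : nat) (S : qset) (g : nat -> option bool) : coin :=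
  if existsb (fun j => S j && chosen (g j))%bool (seq 0 n)
  then ((fun j => S j && chosen (g j))%bool, (fun j => left_side (g j)))
  else ((fun _ => true), (fun _ => true)).

Definition split_family (n : nat) (q : nat -> R) (m : nat) : list (R * coin) :=
  bind (weights n q) (fun i =>
    bind (weights m (fun _ => / INR m)) (fun l =>
      bind (prodm None (tri (/ 2 ^ S l)) n) (fun g =>
        ret (split_coin n (bucket q m (level_of (q i) m)) g)))).

Lemma Ex_tri rho f :
  Ex (tri rho) f = (1 - rho) * f None + rho / 2 * (f (Some true) + f (Some false)).
Proof. unfold Ex; simpl; lra. Qed.

Lemma supp_tri rho : 0 <= rho <= 1 -> supp (fun _ => True) (tri rho).
Proof.
  intros H. unfold tri, supp.
  repeat (apply Forall_cons; [simpl; split; [lra|exact I]|]). apply Forall_nil.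
Qed.

Lemma tri_mass rho : Ex (tri rho) (fun _ => 1) = 1.
Proof. rewrite Ex_tri; lra. Qed.

Lemma inv_pow2_range l : 0 < / 2 ^ l <= 1.
Proof.
  pose proof (pow2_pos l). split; [now apply Rinv_0_lt_compat|].
  rewrite <- Rinv_1. apply Rinv_le_contravar; [lra|]. apply pow_R1_Rle; lra.
Qed.

Lemma split_coin_nonempty n S g :
  (1 <= n)%nat -> nonempty_qset n (fst (split_coin n S g)).
Proof.
  intros Hn. unfold split_coin. destruct (existsb _ _) eqn:E.
  - apply existsb_exists in E as [i [Hi HS]]. apply in_seq in Hi.
    exists i. split; [lia|exact HS].
  - exists O. split; [lia|reflexivity].
Qed.

Lemma split_family_valid n q m :
  (1 <= n)%nat -> (1 <= m)%nat -> is_dist n q -> valid_family n (split_family n q m).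
Proof.
  intros Hn Hm [Hq H1]. assert (0 < INR m) by (apply lt_0_INR; lia). split.
  - eapply supp_bind; [apply supp_weights, Hq|]. intros i _.
    eapply supp_bind; [apply supp_weights; intros; left; now apply Rinv_0_lt_compat|].
    intros l _.
    eapply supp_bind; [apply supp_prodm, supp_tri; pose proof (inv_pow2_range (S l)); lra|].
    intros g _. apply supp_ret. now apply split_coin_nonempty.
  - unfold split_family. rewrite Ex_bind, Ex_weights.
    etransitivity; [|exact H1]. apply rsum_ext; intros i _.
    rewrite Ex_bind, Ex_weights.
    rewrite (rsum_ext m _ (fun _ => / INR m)).
    + rewrite rsum_const. field; lra.
    + intros l _. rewrite Ex_bind.
      rewrite (Ex_ext _ _ (fun _ => 1)) by (intros; apply (Ex_ret _ (fun _ => 1))).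
      rewrite prodm_mass by apply tri_mass. lra.
Qed.

(** Isolates the contribution of i: for both sides b the denominator and the remainders [X], [X1]
    are the same, so the two heads probabilities differ by exactly the share of i. *)
Lemma heads_prob_add_left n p S g i b :
  (forall j, (j < n)%nat -> 0 <= p j) -> (i < n)%nat -> S i = true -> 0 < p i ->
  let X := rsum n (fun j => (if (i =? j)%nat then 0 else if S j then p j else 0)
                            * b2R (chosen (g j))) in
  let X1 := rsum n (fun j => (if (i =? j)%nat then 0 else if S j then p j else 0)
                            * b2R (left_side (g j))) in
  let h := fun j => (S j && chosen (upd g i (Some b) j))%bool in
  massS n p h = p i + X /\
  heads_prob n p (split_coin n S (upd g i (Some b))) = (p i * b2R b + X1) / (p i + X).
Proof.
  intros Hp Hi HS Hpi X X1 h.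
  assert (HX : 0 <= X).
  { apply rsum_nonneg; intros j Hj. specialize (Hp j Hj).
    destruct (i =? j)%nat, (S j), (chosen (g j)); simpl; lra. }
  assert (HM : massS n p h = p i + X).
  { unfold massS. rewrite (rsum_split n i) by exact Hi.
    unfold h at 1. rewrite HS, upd_same. simpl. f_equal.
    apply rsum_ext; intros j Hj. unfold h. destruct (Nat.eqb_spec i j) as [|Hne]; [lra|].
    rewrite upd_other by exact Hne. destruct (S j), (chosen (g j)); simpl; lra. }
  split; [exact HM|].
  unfold split_coin. replace (existsb _ _) with true.
  2:{ symmetry. apply existsb_exists. exists i. split; [apply in_seq; lia|].
      rewrite HS, upd_same. reflexivity. }
  rewrite heads_prob_ratio; fold h; rewrite HM; [|lra]. f_equal.
  unfold massS. rewrite (rsum_split n i) by exact Hi.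
  cbv beta. rewrite HS, upd_same. f_equal.
  - destruct b; simpl; lra.
  - apply rsum_ext; intros j Hj. unfold h. destruct (Nat.eqb_spec i j) as [|Hne]; [lra|].
    rewrite upd_other by exact Hne. destruct (S j), (g j) as [[|]|]; simpl; lra.
Qed.

(* Conditionally on the rest of the split, moving i to the other side changes
   the two heads probabilities by different amounts. *)
Lemma heavy_detected n p q S i theta rho P W :
  (forall j, (j < n)%nat -> 0 <= p j) -> 0 < theta ->
  (forall j, (j < n)%nat -> 0 <= q j) ->
  (forall j, (j < n)%nat -> S j = true -> theta / 2 <= q j <= theta) ->
  P = massS n p S -> W = massS n q S -> 0 < P -> 0 < W ->
  (i < n)%nat -> S i = true -> 100 * q i < W / P * p i ->
  0 < rho <= 1 -> rho * P < p i <= 2 * (rho * P) ->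
  p i / (40 * P) <=
  Ex (prodm None (tri rho) n) (fun g =>
    b2R (far (heads_prob n p (split_coin n S g) - heads_prob n q (split_coin n S g)) (1 / 20)) *
    (if (S i && chosen (g i))%bool
     then p i / massS n p (fun j => S j && chosen (g j))%bool else 0)).
Proof.
  intros Hp Ht Hq0 Hq HPdef HWdef HP HW Hi HS Hheavy Hrho Hpi.
  pose proof (Hq i Hi HS) as Hqi.
  assert (Hqp : 0 < q i) by lra. assert (Hpp : 0 < p i) by nra.
  set (bp := fun j => if (i =? j)%nat then 0 else if S j then p j else 0).
  set (bq := fun j => if (i =? j)%nat then 0 else if S j then q j else 0).
  set (X := fun g => rsum n (fun j => bp j * b2R (chosen (g j)))).
  set (Y := fun g => rsum n (fun j => bq j * b2R (chosen (g j)))).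
  assert (HbP : rsum n bp = P - p i).
  { rewrite HPdef. unfold massS. rewrite (rsum_split n i (fun j => if S j then p j else 0)) by exact Hi.
    rewrite HS. fold bp. ring. }
  assert (HbW : rsum n bq = W - q i).
  { rewrite HWdef. unfold massS. rewrite (rsum_split n i (fun j => if S j then q j else 0)) by exact Hi.
    rewrite HS. fold bq. ring. }
  (* D is how far below its mean [Y] must fall to get under 9 q_i, the event bounded by Chebyshev's
     inequality. *)
  set (D := rho * (W - q i) - 9 * q i).
  set (Z := fun g => Y g - rho * (W - q i)).
  (* Heaviness of i together with p_i <= 2 rho P: the expected q-mass of the subset dwarfs q_i. *)
  assert (HM : 50 * q i < rho * W).
  { assert (100 * q i * P < W * p i).
    { apply Rmult_lt_reg_r with (/ P); [now apply Rinv_0_lt_compat|].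
      replace (100 * q i * P * / P) with (100 * q i) by (field; lra).
      replace (W * p i * / P) with (W / P * p i) by (field; lra). exact Hheavy. }
    nra. }
  assert (HD : 8 / 10 * (rho * W) <= D) by (unfold D; nra).
  (* The bracket is a lower bound for the indicator of X <= 4 p_i and Y >= 9 q_i whose mean is
     accessible by Markov and Chebyshev. On that event i has share at least 1/5 of the p-mass and at
     most 1/10 of the q-mass of the subset. *)
  assert (Hpt : forall g,
    rho / 10 * (1 - X g / (4 * p i) - Z g ^ 2 / D ^ 2) <=
    Ex (tri rho) (fun a =>
      b2R (far (heads_prob n p (split_coin n S (upd g i a))
              - heads_prob n q (split_coin n S (upd g i a))) (1 / 20)) *
      (if (S i && chosen (upd g i a i))%bool
       then p i / massS n p (fun j => S j && chosen (upd g i a j))%bool else 0))).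
  { intros g.
    assert (HX0 : 0 <= X g).
    { apply rsum_nonneg; intros j Hj. specialize (Hp j Hj). unfold bp.
      destruct (i =? j)%nat, (S j), (chosen (g j)); simpl; lra. }
    assert (HY0 : 0 <= Y g).
    { apply rsum_nonneg; intros j Hj. specialize (Hq0 j Hj). unfold bq.
      destruct (i =? j)%nat, (S j), (chosen (g j)); simpl; lra. }
    rewrite Ex_tri, !upd_same, HS. simpl andb. cbv iota. rewrite Rmult_0_r, Rmult_0_r, Rplus_0_l.
    set (x1 := rsum n (fun j => bp j * b2R (left_side (g j)))).
    set (y1 := rsum n (fun j => bq j * b2R (left_side (g j)))).
    assert (M : forall b, massS n p (fun j => (S j && chosen (upd g i (Some b) j))%bool)
                          = p i + X g)
      by exact (fun b => proj1 (heads_prob_add_left n p S g i b Hp Hi HS Hpp)).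
    assert (Ep : forall b, heads_prob n p (split_coin n S (upd g i (Some b)))
                          = (p i * b2R b + x1) / (p i + X g))
      by exact (fun b => proj2 (heads_prob_add_left n p S g i b Hp Hi HS Hpp)).
    assert (Eq : forall b, heads_prob n q (split_coin n S (upd g i (Some b)))
                          = (q i * b2R b + y1) / (q i + Y g))
      by exact (fun b => proj2 (heads_prob_add_left n q S g i b Hq0 Hi HS Hqp)).
    rewrite !M, !Ep, !Eq. change (b2R true) with 1. change (b2R false) with 0.
    set (u := (p i * 1 + x1) / (p i + X g) - (q i * 1 + y1) / (q i + Y g)).
    set (v := (p i * 0 + x1) / (p i + X g) - (q i * 0 + y1) / (q i + Y g)).
    assert (Huv : u - v = p i / (p i + X g) - q i / (q i + Y g))
      by (unfold u, v; field; lra).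
    assert (Hs0 : 0 < p i / (p i + X g)) by (apply Rdiv_lt_0_compat; lra).
    assert (Hhit : forall z, 0 <= b2R (far z (1 / 20)))
      by (intros z; destruct (far _ _); simpl; lra).
    pose proof (Hhit u) as Hu0. pose proof (Hhit v) as Hv0.
    assert (HR0 : 0 <= rho / 2 * (b2R (far u (1 / 20)) * (p i / (p i + X g))
                             + b2R (far v (1 / 20)) * (p i / (p i + X g))))
      by (apply Rmult_le_pos; [lra|nra]).
    assert (HZ0 : 0 <= Z g ^ 2 / D ^ 2)
      by (apply Rle_mult_inv_pos; [apply pow2_ge_0|apply pow_lt; nra]).
    assert (HX4 : 0 <= X g / (4 * p i)) by (apply Rle_mult_inv_pos; lra).
    match goal with |- ?a <= ?b => assert (Hneg :
      1 - X g / (4 * p i) - Z g ^ 2 / D ^ 2 <= 0 -> a <= b) end.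
    { intros Hle. eapply Rle_trans; [|exact HR0].
      pose proof (Rmult_le_compat_l (rho / 10) _ _ ltac:(lra) Hle). lra. }
    destruct (Rlt_dec (4 * p i) (X g)) as [HXbig|HXsmall].
    { assert (1 <= X g / (4 * p i)); [|now apply Hneg; lra].
      apply Rmult_le_reg_r with (4 * p i); [lra|].
      replace (X g / (4 * p i) * (4 * p i)) with (X g) by (field; lra). lra. }
    destruct (Rlt_dec (Y g) (9 * q i)) as [HYsmall|HYbig].
    { assert (1 <= Z g ^ 2 / D ^ 2); [|now apply Hneg; lra].
      assert (0 < D) by nra. assert (0 < D ^ 2) by (apply pow_lt; lra).
      apply Rmult_le_reg_r with (D ^ 2); [lra|].
      replace (Z g ^ 2 / D ^ 2 * D ^ 2) with (Z g ^ 2) by (field; lra).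
      assert (D <= - Z g) by (unfold D, Z; lra). nra. }
    assert (Hs : / 5 <= p i / (p i + X g)).
    { apply Rmult_le_reg_r with (p i + X g); [lra|].
      replace (p i / (p i + X g) * (p i + X g)) with (p i) by (field; lra). lra. }
    assert (Hr : q i / (q i + Y g) <= / 10).
    { apply Rmult_le_reg_r with (q i + Y g); [lra|].
      replace (q i / (q i + Y g) * (q i + Y g)) with (q i) by (field; lra). lra. }
    assert (Hone : 1 <= b2R (far u (1 / 20)) + b2R (far v (1 / 20))).
    { unfold far. destruct (Rlt_dec _ _) as [Hu|]; destruct (Rlt_dec _ _) as [Hv|]; simpl; try lra.
      exfalso. apply Rabs_def2 in Hu, Hv. lra. }
    set (s := p i / (p i + X g)) in *.
    assert (/ 5 <= b2R (far u (1 / 20)) * s + b2R (far v (1 / 20)) * s).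
    { rewrite <- Rmult_plus_distr_r.
      apply Rle_trans with (1 * s); [lra|]. apply Rmult_le_compat_r; lra. }
    apply Rle_trans with (rho / 10 * 1).
    - apply Rmult_le_compat_l; lra.
    - apply Rle_trans with (rho / 2 * / 5); [lra|]. apply Rmult_le_compat_l; lra. }
  rewrite (prodm_resample None (tri rho) (tri_mass rho) n i) by exact Hi.
  eapply Rle_trans; [|eapply Ex_le with (P := fun _ => True);
    [apply supp_prodm, supp_tri; lra | intros g _; apply Hpt]].
  assert (EX : Ex (prodm None (tri rho) n) X = rho * (P - p i)).
  { unfold X.
    rewrite (prodm_mean None (tri rho) (tri_mass rho) n (fun j o => bp j * b2R (chosen o))).
    rewrite <- HbP, <- rsum_scal. apply rsum_ext; intros j _. rewrite Ex_tri; simpl; lra. }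
  assert (EZ : Ex (prodm None (tri rho) n) (fun g => Z g ^ 2) <= rho * theta * W).
  { rewrite (Ex_ext _ _ (fun g => rsum n (fun j => bq j * (b2R (chosen (g j)) - rho)) ^ 2)).
    - rewrite (prodm_second_moment None (tri rho) (tri_mass rho) n
                 (fun j o => bq j * (b2R (chosen o) - rho))).
      + rewrite HWdef. unfold massS. rewrite <- rsum_scal.
        apply rsum_le; intros j Hj. rewrite Ex_tri. simpl. unfold bq.
        specialize (Hq j Hj).
        destruct (i =? j)%nat; destruct (S j); try lra;
          specialize (Hq eq_refl); [apply Rle_trans with 0; [right; ring|]; apply Rmult_le_pos; [apply Rmult_le_pos|]; lra|].
        replace ((1 - rho) * (q j * (0 - rho) * (q j * (0 - rho) * 1)) +
           rho / 2 * (q j * (1 - rho) * (q j * (1 - rho) * 1)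
                      + q j * (1 - rho) * (q j * (1 - rho) * 1)))
          with (rho * (1 - rho) * (q j * q j)) by field.
        apply Rle_trans with (rho * 1 * (theta * q j)); [|lra].
        apply Rmult_le_compat; [nra|nra|nra|nra].
      + intros j _. rewrite Ex_tri; simpl; lra.
    - intros g. f_equal. unfold Z, Y. rewrite <- HbW, <- rsum_scal, <- rsum_minus.
      apply rsum_ext; intros; ring. }
  rewrite Ex_scal.
  rewrite (Ex_ext _ _ (fun g => (1 - / (4 * p i) * X g) - / D ^ 2 * Z g ^ 2))
    by (intros; unfold Rdiv; ring).
  rewrite !Ex_minus, !Ex_scal, prodm_mass by apply tri_mass.
  change (Ex (prodm None (tri rho) n) (fun a => X a)) with (Ex (prodm None (tri rho) n) X).
  rewrite EX.
  assert (H1 : / (4 * p i) * (rho * (P - p i)) <= / 4).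
  { apply Rmult_le_reg_l with (4 * p i); [lra|].
    rewrite <- Rmult_assoc, Rinv_r, Rmult_1_l by lra. nra. }
  assert (H2 : / D ^ 2 * Ex (prodm None (tri rho) n) (fun g => Z g ^ 2) <= / 4).
  { assert (HD2 : 0 < D ^ 2) by (apply pow_lt; nra).
    apply Rmult_le_reg_l with (D ^ 2); [exact HD2|].
    rewrite <- Rmult_assoc, Rinv_r, Rmult_1_l by lra.
    eapply Rle_trans; [exact EZ|].
    set (M := rho * W) in *.
    replace (rho * theta * W) with (theta * M) by (unfold M; ring).
    assert ((8 / 10 * M) ^ 2 <= D ^ 2) by (apply pow_incr; nra).
    assert (theta <= 2 * q i) by lra. nra. }
  (* The two exceptional events cost 1/4 each; then p_i <= 2 rho P bounds p_i / (40 P) by rho /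
     20. *)
  apply Rle_trans with (rho / 10 * / 2).
  - apply Rmult_le_reg_r with (40 * P); [lra|].
    replace (p i / (40 * P) * (40 * P)) with (p i) by (field; lra). lra.
  - apply Rmult_le_compat_l; lra.
Qed.

(** One split may expose several heavy elements, so detections cannot simply be added. Weighting
    each by the share of i in the p-mass of the chosen subset repairs this: shares sum to at most 1,
    and [heavy_detected] bounds exactly the weighted probability, at the density matching p_i /
    P. *)
Lemma bucket_splits n p q S theta m c :
  (forall j, (j < n)%nat -> 0 <= p j) -> 0 < theta ->
  (forall j, (j < n)%nat -> 0 <= q j) ->
  (forall j, (j < n)%nat -> S j = true -> theta / 2 <= q j <= theta) ->
  0 < massS n p S -> 0 < massS n q S -> INR n <= 2 ^ m ->
  c = massS n q S / massS n p S ->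
  / 40 * (massS n (heavy_part c p q) S / massS n q S) <=
  rsum m (fun l => Ex (prodm None (tri (/ 2 ^ Datatypes.S l)) n) (fun g =>
    b2R (far (heads_prob n p (split_coin n S g) - heads_prob n q (split_coin n S g)) (1 / 20)))).
Proof.
  intros Hp Ht Hq0 Hq HP HW Hm Hc.
  set (P := massS n p S) in *. set (W := massS n q S) in *.
  assert (Hcp : 0 < c) by (rewrite Hc; now apply Rdiv_lt_0_compat).
  set (hit := fun g => b2R (far (heads_prob n p (split_coin n S g)
                              - heads_prob n q (split_coin n S g)) (1 / 20))).
  set (share := fun g i => if (S i && chosen (g i))%bool
     then p i / massS n p (fun j => S j && chosen (g j))%bool else 0).
  assert (Hhit : forall g, 0 <= hit g) by (intros g; unfold hit; destruct (far _ _); simpl; lra).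
  assert (Hshare0 : forall g i, (i < n)%nat -> 0 <= share g i).
  { intros g i Hi. unfold share. destruct (S i && chosen (g i))%bool; [|lra].
    specialize (Hp i Hi) as Hpi. pose proof (massS_nonneg n p
      (fun j => S j && chosen (g j))%bool Hp) as [HM|HM].
    - now apply Rle_mult_inv_pos.
    (* A chosen subset of p-mass 0 gives share 0, as [/ 0] is 0. *)
    - rewrite <- HM. unfold Rdiv. rewrite Rinv_0; lra. }
  assert (Hshare1 : forall g, rsum n (share g) <= 1).
  { intros g. unfold share.
    set (M := massS n p (fun j => S j && chosen (g j))%bool).
    rewrite (rsum_ext n _ (fun i => (if (S i && chosen (g i))%bool then p i else 0) * / M)).
    - rewrite rsum_scal_r. fold (massS n p (fun j => S j && chosen (g j))%bool). fold M.
      destruct (Req_dec M 0) as [->|HM]; [lra|]. rewrite Rinv_r; lra.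
    - intros i _. destruct (S i && chosen (g i))%bool; unfold Rdiv; lra. }
  assert (Hpoint : forall g, rsum n (fun i => hit g * share g i) <= hit g).
  { intros g. rewrite rsum_scal. specialize (Hhit g). specialize (Hshare1 g). nra. }
  set (lev := fun i => level_of (p i / P) m).
  apply Rle_trans with (rsum m (fun l => rsum n (fun i =>
    if (lev i =? l)%nat then (if S i then heavy_part c p q i / (40 * W) else 0) else 0))).
  - rewrite rsum_swap.
    apply Rle_trans with (rsum n (fun i => if S i then heavy_part c p q i / (40 * W) else 0)).
    + right. unfold massS, Rdiv. rewrite <- rsum_scal_r, <- rsum_scal.
      apply rsum_ext; intros i _. destruct (S i); field; lra.
    + apply rsum_le; intros i Hi. destruct (S i) eqn:HS.
      * unfold heavy_part. destruct (Rlt_dec _ _) as [Hheavy|].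
        -- rewrite rsum_delta; [lra|].
           (* A heavy element lies strictly above the last level: otherwise p_i / P <= 2^-m <= 1 /
              n, and W <= n theta would give c p_i <= theta <= 2 q_i. *)
           destruct (Nat.eq_dec (lev i) m) as [E|E];
             [exfalso|pose proof (level_of_le (p i / P) m); fold (lev i) in *; lia].
           assert (Hle : p i / P <= / 2 ^ m).
           { rewrite <- E. apply level_of_upper. apply Rmult_le_reg_r with P; [exact HP|].
             replace (p i / P * P) with (p i) by (field; lra).
             rewrite Rmult_1_l. now apply massS_term_le. }
           assert (HWn : W <= INR n * theta).
           { rewrite <- rsum_const. apply rsum_le; intros j Hj. specialize (Hq j Hj).
             destruct (S j); [specialize (Hq eq_refl)|]; lra. }
           pose proof (Hq i Hi HS). pose proof (pow2_pos m).
           replace (c * p i) with (W * (p i / P)) in Hheavy by (rewrite Hc; field; lra).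
           assert (W * (p i / P) <= W * / 2 ^ m) by (apply Rmult_le_compat_l; lra).
           assert (W * / 2 ^ m <= theta); [|lra].
           apply Rmult_le_reg_r with (2 ^ m); [lra|].
           rewrite Rmult_assoc, Rinv_l, Rmult_1_r by lra. nra.
        -- unfold Rdiv. rewrite Rmult_0_l. apply rsum_nonneg; intros. destruct (_ =? _)%nat; lra.
      * apply rsum_nonneg; intros. destruct (_ =? _)%nat; lra.
  - apply rsum_le; intros l Hl.
    eapply Rle_trans; [|apply Ex_le with (P := fun _ => True);
      [apply supp_prodm, supp_tri; pose proof (inv_pow2_range (Datatypes.S l)); lra
      |intros g _; apply Hpoint]].
    rewrite Ex_rsum. apply rsum_le; intros i Hi.
    assert (H0 : 0 <= Ex (prodm None (tri (/ 2 ^ Datatypes.S l)) n)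
                        (fun g => hit g * share g i)).
    { apply Ex_nonneg with (fun _ => True);
        [apply supp_prodm, supp_tri; pose proof (inv_pow2_range (Datatypes.S l)); lra|].
      intros g _. apply Rmult_le_pos; auto. }
    destruct (Nat.eqb_spec (lev i) l) as [El|]; [|exact H0].
    destruct (S i) eqn:HS; [|exact H0].
    unfold heavy_part. destruct (Rlt_dec _ _) as [Hheavy|]; [|unfold Rdiv; rewrite Rmult_0_l; exact H0].
    assert (Hlow : / 2 ^ Datatypes.S l < p i / P).
    { rewrite <- El. apply level_of_lower. fold (lev i). lia. }
    assert (Hup : p i / P <= / 2 ^ l).
    { rewrite <- El. apply level_of_upper. apply Rmult_le_reg_r with P; [exact HP|].
      replace (p i / P * P) with (p i) by (field; lra).
      rewrite Rmult_1_l. now apply massS_term_le. }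
    replace (c * p i / (40 * W)) with (p i / (40 * P)) by (rewrite Hc; field; lra).
    assert (Epi : p i = p i / P * P) by (field; lra).
    apply heavy_detected with (theta := theta) (P := P) (W := W); auto.
    + now rewrite <- Hc.
    + pose proof (inv_pow2_range (Datatypes.S l)); lra.
    + rewrite Epi.
      assert (E2 : / 2 ^ l = 2 * / 2 ^ Datatypes.S l)
        by (simpl pow; pose proof (pow2_pos l); field; lra).
      rewrite E2 in Hup. split; nra.
Qed.

(** * Far distributions deviate on one of the three families *)

Lemma bucket_range n q m k i :
  is_dist n q -> (i < n)%nat -> (k < m)%nat -> bucket q m k i = true ->
  / 2 ^ k / 2 <= q i <= / 2 ^ k.
Proof.
  intros [Hq H1] Hi Hk HB. apply Nat.eqb_eq in HB.
  assert (Hqi : q i <= 1) by (rewrite <- H1; now apply rsum_term_le).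
  split.
  - left. pose proof (level_of_lower (q i) m) as HL. rewrite HB in HL.
    specialize (HL Hk). replace (/ 2 ^ k / 2) with (/ 2 ^ S k); [exact HL|].
    simpl pow. pose proof (pow2_pos k). field; lra.
  - rewrite <- HB. now apply level_of_upper.
Qed.

Lemma bucket_q_pos n p q m k :
  is_dist n q -> (k < m)%nat -> 0 < massS n p (bucket q m k) -> 0 < massS n q (bucket q m k).
Proof.
  intros Hq Hk HP.
  destruct (existsb (bucket q m k) (seq 0 n)) eqn:E.
  - apply existsb_exists in E as [i [Hi HB]]. apply in_seq in Hi.
    destruct (bucket_range n q m k i Hq ltac:(lia) Hk HB) as [Hlow _].
    pose proof (inv_pow2_range k).
    apply Rlt_le_trans with (q i); [lra|]. apply massS_term_le; [apply Hq|lia|exact HB].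
  - exfalso. replace (massS n p (bucket q m k)) with 0 in HP; [lra|].
    symmetry. unfold massS. rewrite (rsum_ext n _ (fun _ => 0)); [apply rsum_0|].
    intros i Hi. destruct (bucket q m k i) eqn:HB; [|reflexivity].
    assert (existsb (bucket q m k) (seq 0 n) = true); [|congruence].
    apply existsb_exists. exists i. split; [apply in_seq; lia|exact HB].
Qed.

Lemma light_bucket_mass n q m :
  is_dist n q -> massS n q (bucket q m m) <= INR n * / 2 ^ m.
Proof.
  intros [Hq H1]. rewrite <- rsum_const. apply rsum_le; intros i Hi.
  destruct (bucket q m m i) eqn:HB; [|left; apply inv_pow2_range].
  apply Nat.eqb_eq in HB. rewrite <- HB at 1. apply level_of_upper.
  rewrite <- H1. now apply rsum_term_le.
Qed.

(** If p has no mass on S, no rescaling factor exists; the default 0 is right because the l1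
    distance on S is then |P - W| itself. *)
Definition rescaled (n : nat) (p q : nat -> R) (S : qset) (F : R -> R) : R :=
  if Rlt_dec 0 (massS n p S) then F (massS n q S / massS n p S) else 0.

Definition bucket_distance (n : nat) (p q : nat -> R) (m k : nat) : R :=
  rescaled n p q (bucket q m k) (fun c => massS n (fun i => Rabs (c * p i - q i)) (bucket q m k)).

Definition bucket_heavy (n : nat) (p q : nat -> R) (m k : nat) : R :=
  rescaled n p q (bucket q m k) (fun c => massS n (heavy_part c p q) (bucket q m k)).

Lemma bucket_l1_le n p q m k :
  is_dist n p -> is_dist n q -> (k < m)%nat ->
  massS n (fun i => Rabs (p i - q i)) (bucket q m k) <=
  Rabs (massS n p (bucket q m k) - massS n q (bucket q m k)) + bucket_distance n p q m k.
Proof.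
  intros [Hp _] Hq Hk. unfold bucket_distance, rescaled.
  set (B := bucket q m k). set (P := massS n p B). set (W := massS n q B).
  destruct (Rlt_dec 0 P) as [HP|HP].
  - set (c := W / P).
    apply Rle_trans with (massS n (fun i => Rabs (1 - c) * p i + Rabs (c * p i - q i)) B).
    + apply massS_le; intros i Hi _.
      replace (p i - q i) with ((1 - c) * p i + (c * p i - q i)) by ring.
      eapply Rle_trans; [apply Rabs_triang|]. rewrite Rabs_mult, (Rabs_right (p i)).
      * lra.
      * apply Rle_ge, Hp, Hi.
    + rewrite massS_plus, massS_scal. fold P. apply Rplus_le_compat_r.
      replace (P - W) with ((1 - c) * P) by (unfold c; field; lra).
      rewrite Rabs_mult, (Rabs_right P); lra.
  - pose proof (massS_nonneg n p B Hp) as HP0. fold P in HP0.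
    pose proof (massS_nonneg n q B (proj1 Hq)) as HW0. fold W in HW0.
    replace P with 0 by lra. rewrite Rplus_0_r, Rabs_left1 by lra.
    apply Rle_trans with (massS n (fun i => p i + q i) B).
    + apply massS_le; intros i Hi _. specialize (Hp i Hi). destruct Hq as [Hq _].
      specialize (Hq i Hi). apply Rabs_le; lra.
    + rewrite massS_plus. fold P W. lra.
Qed.

Lemma pair_family_mean n p q m :
  is_dist n p -> is_dist n q ->
  / 1600 * rsum m (fun k => / 2 * bucket_distance n p q m k - bucket_heavy n p q m k) <=
  Ex (pair_family n q m) (fun c => Rabs (heads_prob n p c - heads_prob n q c)).
Proof.
  intros Hp Hq.
  set (Y := fun i j => Rabs (heads_prob n p (pair_coin i j) - heads_prob n q (pair_coin i j))).
  set (T := fun k => massS n (fun i => q i * rsum n (fun j =>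
              cond_prob n q (bucket q m k) j * Y i j)) (bucket q m k)).
  assert (E : Ex (pair_family n q m)
                (fun c => Rabs (heads_prob n p c - heads_prob n q c)) = rsum (S m) T).
  { unfold pair_family. rewrite Ex_bind, Ex_weights.
    rewrite <- (massS_buckets n q m). apply rsum_ext; intros k _.
    apply massS_ext; intros i Hi HB. apply Nat.eqb_eq in HB. rewrite HB.
    rewrite Ex_bind, Ex_weights. f_equal. apply rsum_ext; intros j _.
    now rewrite Ex_ret. }
  assert (HT0 : forall k, 0 <= T k).
  { intros k. apply rsum_nonneg; intros i Hi.
    destruct (bucket q m k i) eqn:HB; [|lra].
    apply Rmult_le_pos; [now apply Hq|]. apply rsum_nonneg; intros j Hj.
    apply Rmult_le_pos; [|apply Rabs_pos].
    apply cond_prob_nonneg; [apply Hq| |exact Hj]. now exists i. }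
  (* Bucket m has no lower bound on q, so only the sign of its term is used. *)
  rewrite E, rsum_S, <- rsum_scal. specialize (HT0 m) as Hm0.
  apply Rle_trans with (rsum m T); [|lra].
  apply rsum_le; intros k Hk. unfold bucket_distance, bucket_heavy, rescaled.
  destruct (Rlt_dec 0 _) as [HP|_]; [|rewrite Rmult_0_r, Rminus_diag, Rmult_0_r; apply HT0].
  pose proof (bucket_q_pos n p q m k Hq Hk HP) as HW.
  eapply Rle_trans; [apply bucket_pairs with (theta := / 2 ^ k)|].
  - apply Hp.
  - apply inv_pow2_range.
  - now apply Rdiv_lt_0_compat.
  - intros i Hi HB. now apply (bucket_range n q m).
  - exact HW.
  - field; lra.
  - right. apply massS_ext; intros i Hi _. f_equal.
    apply rsum_ext; intros j Hj. unfold cond_prob.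
    destruct (bucket q m k j); [|lra].
    destruct (Req_dec_T _ _); [lra|]. reflexivity.
Qed.

Lemma split_family_detection n p q m :
  is_dist n p -> is_dist n q -> (1 <= m)%nat -> INR n <= 2 ^ m ->
  / (40 * INR m) * rsum m (bucket_heavy n p q m) <=
  Ex (split_family n q m)
    (fun c => b2R (far (heads_prob n p c - heads_prob n q c) (1 / 20))).
Proof.
  intros Hp Hq Hm Hnm. assert (Hm0 : 0 < INR m) by (apply lt_0_INR; lia).
  set (H := fun k l => Ex (prodm None (tri (/ 2 ^ S l)) n) (fun g =>
     b2R (far (heads_prob n p (split_coin n (bucket q m k) g)
             - heads_prob n q (split_coin n (bucket q m k) g)) (1 / 20)))).
  assert (HH0 : forall k, 0 <= rsum m (H k)).
  { intros k. apply rsum_nonneg; intros l _. apply Ex_nonneg with (fun _ => True).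
    - apply supp_prodm, supp_tri. pose proof (inv_pow2_range (S l)); lra.
    - intros g _. destruct (far _ _); simpl; lra. }
  set (T := fun k => massS n q (bucket q m k) * (/ INR m * rsum m (H k))).
  assert (E : Ex (split_family n q m)
     (fun c => b2R (far (heads_prob n p c - heads_prob n q c) (1 / 20))) = rsum (S m) T).
  { unfold split_family. rewrite Ex_bind, Ex_weights.
    rewrite <- (massS_buckets n q m). apply rsum_ext; intros k _.
    unfold T. rewrite Rmult_comm, <- massS_scal.
    apply massS_ext; intros i Hi HB. apply Nat.eqb_eq in HB. rewrite HB.
    rewrite Ex_bind, Ex_weights, rsum_scal, Rmult_comm. f_equal. f_equal.
    apply rsum_ext; intros l _. rewrite Ex_bind. apply Ex_ext; intros g.
    now rewrite Ex_ret. }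
  assert (HT0 : forall k, 0 <= T k).
  { intros k. apply Rmult_le_pos; [apply massS_nonneg, Hq|].
    apply Rmult_le_pos; [left; now apply Rinv_0_lt_compat|apply HH0]. }
  rewrite E, rsum_S, <- rsum_scal. specialize (HT0 m) as Hlast.
  apply Rle_trans with (rsum m T); [|lra].
  apply rsum_le; intros k Hk. unfold bucket_heavy, rescaled.
  destruct (Rlt_dec 0 _) as [HP|_]; [|rewrite Rmult_0_r; apply HT0].
  pose proof (bucket_q_pos n p q m k Hq Hk HP) as HW.
  assert (HB := bucket_splits n p q (bucket q m k) (/ 2 ^ k) m _ (proj1 Hp)
     (proj1 (inv_pow2_range k)) (proj1 Hq)
     (fun i Hi HB => bucket_range n q m k i Hq Hi Hk HB) HP HW Hnm eq_refl).
  fold (H k) in HB. unfold T.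
  set (W := massS n q (bucket q m k)) in *. set (mu := massS n (heavy_part _ _ _) _) in *.
  replace (/ (40 * INR m) * mu) with (W * (/ INR m * (/ 40 * (mu / W)))) by (field; lra).
  apply Rmult_le_compat_l; [lra|]. apply Rmult_le_compat_l; [left; now apply Rinv_0_lt_compat|].
  exact HB.
Qed.

(** The l1 distance 2 eps splits into bucket mass differences, distances inside buckets, and at most
    eps / 8 from the last bucket. If mass differences and heavy parts both stay below eps / 4, the
    inner distances exceed 13 eps / 8, and half of that minus eps / 4 is more than eps / 2. *)
Lemma deviation_trichotomy n p q m eps :
  is_dist n p -> is_dist n q -> 0 < eps <= 1 -> eps <= dTV n p q -> (1 <= m)%nat ->
  16 * INR n <= eps * 2 ^ m ->
  eps / 4 <= rsum (S m) (fun k =>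
     Rabs (massS n p (bucket q m k) - massS n q (bucket q m k))) \/
  eps / 3200 <= Ex (pair_family n q m)
     (fun c => Rabs (heads_prob n p c - heads_prob n q c)) \/
  eps / (160 * INR m) <= Ex (split_family n q m)
     (fun c => b2R (far (heads_prob n p c - heads_prob n q c) (1 / 20))).
Proof.
  intros Hp Hq He Hd Hm Hn. assert (Hm0 : 0 < INR m) by (apply lt_0_INR; lia).
  set (x := fun k => Rabs (massS n p (bucket q m k) - massS n q (bucket q m k))).
  pose proof (pow2_pos m) as H2m. pose proof (pos_INR n) as Hn0.
  assert (Hlight : massS n q (bucket q m m) <= eps / 16).
  { eapply Rle_trans; [now apply light_bucket_mass|].
    apply Rmult_le_reg_r with (2 ^ m); [lra|].
    rewrite Rmult_assoc, Rinv_l by lra. lra. }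
  assert (Htot : 2 * eps <= rsum (S m) x + rsum m (bucket_distance n p q m) + eps / 8).
  { unfold dTV in Hd.
    rewrite <- (massS_buckets n q m (fun i => Rabs (p i - q i))) in Hd.
    rewrite rsum_S in Hd. rewrite (rsum_S m x).
    assert (rsum m (fun k => massS n (fun i => Rabs (p i - q i)) (bucket q m k)) <=
            rsum m x + rsum m (bucket_distance n p q m)).
    { rewrite <- rsum_plus. apply rsum_le; intros k Hk. now apply bucket_l1_le. }
    (* On the light bucket p + q has mass (P - W) + 2 W, with W <= eps / 16. *)
    assert (massS n (fun i => Rabs (p i - q i)) (bucket q m m) <= x m + eps / 8).
    { apply Rle_trans with (massS n (fun i => p i + q i) (bucket q m m)).
      - apply massS_le; intros i Hi _. destruct Hp as [Hp _], Hq as [Hq _].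
        specialize (Hp i Hi). specialize (Hq i Hi). apply Rabs_le; lra.
      - rewrite massS_plus. unfold x.
        pose proof (Rle_abs (massS n p (bucket q m m) - massS n q (bucket q m m))). lra. }
    lra. }
  destruct (Rle_dec (eps / 4) (rsum (S m) x)) as [|Hx]; [now left|right].
  destruct (Rle_dec (eps / 4) (rsum m (bucket_heavy n p q m))) as [Hmu|Hmu]; [right|left].
  - eapply Rle_trans; [|apply split_family_detection; auto; nra].
    apply Rle_trans with (/ (40 * INR m) * (eps / 4)).
    + right. field; lra.
    + apply Rmult_le_compat_l; [|exact Hmu]. left. apply Rinv_0_lt_compat; lra.
  - eapply Rle_trans; [|now apply pair_family_mean].
    rewrite rsum_minus, rsum_scal. lra.
Qed.

(** * The identity tester *)

Definition identity_tester (n : nat) (q : nat -> R) (m J0 J1 J2 : nat) : tester :=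
  tester_and (mean_tester n q (coarse_family q m) J0 (S J0))
    (tester_and (mean_tester n q (pair_family n q m) J1 (S J1))
       (coin_tester n q (split_family n q m) (2 ^ J2) (100 * (1024 * S J2)) (1 / 20))).

Definition identity_cost (J0 J1 J2 : nat) : nat :=
  mean_cost J0 (S J0) + (mean_cost J1 (S J1) + 2 ^ J2 * (100 * (1024 * S J2))).

Lemma identity_tester_sound n q m J0 J1 J2 :
  (1 <= n)%nat -> (1 <= m)%nat -> is_dist n q ->
  sound_tester n (identity_cost J0 J1 J2) (identity_tester n q m J0 J1 J2).
Proof.
  intros Hn Hm Hq. apply tester_and_sound; [apply mean_tester_sound, coarse_family_valid, Hn|].
  apply tester_and_sound; [apply mean_tester_sound, pair_family_valid, Hq|].
  apply coin_tester_sound, split_family_valid; assumption.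
Qed.

(** Explains 100 . 1024 = 8 . 32 . 20^2; the factor [S J] keeps the error of all 2^J coins together
    below 2 / 256. *)
Lemma split_exponent J : INR (100 * (1024 * S J)) * (1 / 20) ^ 2 / 32 = 8 * INR (S J).
Proof.
  rewrite !mult_INR. replace (INR 1024) with 1024 by (rewrite INR_IZR_INZ; reflexivity).
  replace (INR 100) with 100 by (rewrite INR_IZR_INZ; reflexivity).
  field.
Qed.

(** Under p = q the three errors are at most 12/256, 12/256 and 2/256. In the far case one test
    alone accepts with probability at most 1/3. The constant 480 is 3 . 160: at least 3 deviating
    splits are expected, and exp (-3/2) <= 1/3. *)
Lemma identity_tester_distinguishes n q m J0 J1 J2 eps :
  (1 <= n)%nat -> (1 <= m)%nat -> is_dist n q -> 0 < eps <= 1 ->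
  16 * INR n <= eps * 2 ^ m ->
  / 2 ^ J0 <= 3 / 80 * (eps / sqrt (INR (S m))) ->
  / 2 ^ J1 <= eps / 3200 ->
  480 * INR m / eps <= 2 ^ J2 ->
  distinguishes n q eps (1 / 3) (identity_tester n q m J0 J1 J2).
Proof.
  intros Hn Hm Hq He Hnm HJ0 HJ1 HJ2.
  pose proof (coarse_family_valid n q m Hn) as V0.
  pose proof (pair_family_valid n q m Hq) as V1.
  pose proof (split_family_valid n q m Hn Hm Hq) as V2.
  assert (Ht : 0 <= 1 / 20 <= 1) by lra.
  assert (Hm0 : 0 < INR m) by (apply lt_0_INR; lia).
  unfold distinguishes, identity_tester.
  split; intros p Hp Hpq; rewrite !tester_and_accept;
    assert (Hp0 := proj1 Hp);
    pose proof (accept_prob_range n _ p _ Hp0 (mean_tester_sound n q _ J0 (S J0) V0)) as R0;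
    pose proof (accept_prob_range n _ p _ Hp0 (mean_tester_sound n q _ J1 (S J1) V1)) as R1;
    pose proof (accept_prob_range n _ p _ Hp0
      (coin_tester_sound n q _ (2 ^ J2) (100 * (1024 * S J2)) (1 / 20) V2)) as R2.
  - pose proof (mean_tester_null n p q _ J0 V0 Hp0 Hpq) as A0.
    pose proof (mean_tester_null n p q _ J1 V1 Hp0 Hpq) as A1.
    pose proof (coin_tester_null n p q _ (2 ^ J2) (100 * (1024 * S J2)) (1 / 20) V2 Hp0 Hpq Ht) as A2.
    rewrite split_exponent in A2.
    assert (E : INR (2 ^ J2) * (2 * exp (- (8 * INR (S J2)))) <= 2 / 256).
    { rewrite pow_INR. replace (INR 2) with 2 by (simpl; lra).
      pose proof (exp_neg_8_mult_le (S J2)) as Hx. simpl pow in Hx.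
      pose proof (pow2_pos J2).
      apply Rle_trans with (2 ^ J2 * (2 * (/ 256 * (/ 256) ^ J2))); [nra|].
      assert (2 ^ J2 * (/ 256) ^ J2 <= 1); [|lra].
      rewrite <- Rpow_mult_distr, <- (pow1 J2). apply pow_incr; lra. }
    set (a0 := accept_prob n p (mean_tester n q (coarse_family q m) J0 (S J0))) in *.
    set (a1 := accept_prob n p (mean_tester n q (pair_family n q m) J1 (S J1))) in *.
    set (a2 := accept_prob n p (coin_tester _ _ _ _ _ _)) in *.
    assert (1 - 12 / 256 - 2 / 256 <= a1 * a2) by nra. nra.
  - apply Rge_le in Hpq.
    set (a0 := accept_prob n p (mean_tester n q (coarse_family q m) J0 (S J0))) in *.
    set (a1 := accept_prob n p (mean_tester n q (pair_family n q m) J1 (S J1))) in *.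
    set (a2 := accept_prob n p (coin_tester _ _ _ _ _ _)) in *.
    assert (H : a0 <= 1 / 3 \/ a1 <= 1 / 3 \/ a2 <= 1 / 3).
    { destruct (deviation_trichotomy n p q m eps Hp Hq He Hpq Hm Hnm) as [H|[H|H]].
      - left. apply mean_tester_alt; auto; [apply Hq|].
        eapply Rle_trans; [exact HJ0|].
        eapply Rle_trans; [|apply coarse_deviation; [exact Hp|exact Hq| |exact H]; lra].
        right. field. apply Rgt_not_eq, sqrt_lt_R0, lt_0_INR; lia.
      - right; left. apply mean_tester_alt; auto; [apply Hq|lra].
      - right; right. eapply Rle_trans; [apply coin_tester_alt; auto|].
        + rewrite split_exponent, S_INR. pose proof (pos_INR J2); lra.
        + eapply Rle_trans; [|apply exp_neg_three_halves]. apply exp_le_compat.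
          match goal with |- - (_ * ?e / 2) <= _ => set (P := e) in * end.
          rewrite pow_INR. replace (INR 2) with 2 by (simpl; lra).
          assert (3 <= 2 ^ J2 * P); [|lra].
          apply Rle_trans with (480 * INR m / eps * (eps / (160 * INR m))).
          * right. field; lra.
          * apply Rmult_le_compat; [|apply Rle_mult_inv_pos; lra|exact HJ2|exact H].
            apply Rle_mult_inv_pos; lra. }
    assert (a0 * (a1 * a2) <= 1 / 3); [|lra].
    assert (0 <= a1 * a2 <= 1) by nra.
    destruct H as [H|[H|H]]; nra.
Qed.

(** * Choice of parameters and number of queries *)

Lemma pow2_sandwich x : 1 <= x -> exists J, x <= 2 ^ J <= 2 * x.
Proof.
  intros Hx.
  assert (HN : exists N, x <= 2 ^ N).
  { destruct (INR_unbounded x) as [N HN]. exists N.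
    assert (forall k, INR k <= 2 ^ k).
    { induction k as [|k IH]; [simpl; lra|]. rewrite S_INR; simpl pow.
      pose proof (pow_R1_Rle 2 k ltac:(lra)). lra. }
    specialize (H N). lra. }
  destruct HN as [N HN]. induction N as [|N IH].
  - exists O. simpl in *. lra.
  - destruct (Rle_dec x (2 ^ N)) as [H|H]; [now apply IH|].
    exists (S N). simpl in *. lra.
Qed.

Lemma ln_le_sub_1 x : 0 < x -> ln x <= x - 1.
Proof.
  intros Hx. pose proof (exp_ineq1_le (ln x)) as H. rewrite exp_ln in H by exact Hx. lra.
Qed.

Lemma ln_le_compat x y : 0 < x -> x <= y -> ln x <= ln y.
Proof. intros Hx [H|H]; [left; now apply ln_increasing | right; now rewrite H]. Qed.

Lemma ln_pow2 k : ln (2 ^ k) = INR k * ln 2.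
Proof. apply ln_pow; lra. Qed.

Lemma ln_2_range : / 2 < ln 2 <= 1.
Proof. split; [apply ln_lt_2|]. pose proof (ln_le_sub_1 2 ltac:(lra)). lra. Qed.

Lemma log2_mul_ln2 x : log2 x * ln 2 = ln x.
Proof. unfold log2. field. pose proof ln_2_range; lra. Qed.

(** 4^J0 is of order L / eps^2 and 4^J1 of order 1 / eps^2. The splits use 2^J2 (J2 + 1), of order
    (L / eps)(1 + ln L + ln (1 / eps)), and ln (1 / eps) is absorbed by 1 / eps. *)
Lemma identity_cost_bound a L eps m J0 J1 J2 :
  1 <= L -> 0 < eps <= 1 -> ln a = L * ln 2 -> 0 < a ->
  2 ^ m <= 32 * a ->
  2 ^ J0 <= 2 * (80 / 3 * (sqrt (INR (S m)) / eps)) ->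
  2 ^ J1 <= 2 * (3200 / eps) ->
  2 ^ J2 <= 2 * (480 * INR m / eps) -> (1 <= m)%nat ->
  INR (identity_cost J0 J1 J2) <= 10 ^ 12 * (L * (1 + ln L) / eps ^ 2).
Proof.
  intros HL He Ha Ha0 Hm H0 H1 H2 Hm1.
  pose proof ln_2_range as Hln2.
  assert (HlnL : 0 <= ln L) by (rewrite <- ln_1; apply ln_le_compat; lra).
  assert (Hm0 : 0 < INR m) by (apply lt_0_INR; lia).
  assert (HmL : INR m <= 6 * L).
  { apply Rmult_le_reg_r with (ln 2); [lra|]. rewrite <- ln_pow2.
    apply Rle_trans with (ln (2 ^ 5 * a)); [apply ln_le_compat; [apply pow2_pos|lra]|].
    rewrite ln_mult, ln_pow2, Ha by (lra || apply pow2_pos). simpl INR. nra. }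
  assert (Hie : 1 <= / eps) by (rewrite <- Rinv_1; apply Rinv_le_contravar; lra).
  assert (Hie2 : 0 < / eps ^ 2) by (apply Rinv_0_lt_compat, pow_lt; lra).
  assert (E0 : 4 ^ J0 <= 20000 * L / eps ^ 2).
  { rewrite pow4. apply Rle_trans with ((2 * (80 / 3 * (sqrt (INR (S m)) / eps))) ^ 2).
    - apply pow_incr. split; [left; apply pow2_pos|exact H0].
    - replace ((2 * (80 / 3 * (sqrt (INR (S m)) / eps))) ^ 2)
        with (25600 / 9 * (sqrt (INR (S m)) * sqrt (INR (S m))) / eps ^ 2) by (field; lra).
      rewrite sqrt_sqrt by apply pos_INR. rewrite S_INR.
      apply Rmult_le_compat_r; [lra|]. lra. }
  assert (E1 : 4 ^ J1 <= 40960000 / eps ^ 2).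
  { rewrite pow4. apply Rle_trans with ((2 * (3200 / eps)) ^ 2).
    - apply pow_incr. split; [left; apply pow2_pos|exact H1].
    - right. field. lra. }
  assert (E2 : 2 ^ J2 <= 5760 * L * / eps).
  { eapply Rle_trans; [exact H2|].
    replace (2 * (480 * INR m / eps)) with (960 * INR m * / eps) by (unfold Rdiv; ring).
    apply Rmult_le_compat_r; lra. }
  assert (E3 : INR (S J2) <= 16 * (1 + ln L) * / eps).
  { assert (INR J2 * ln 2 <= 13 * ln 2 + ln L + / eps).
    { rewrite <- ln_pow2.
      apply Rle_trans with (ln (2 ^ 13 * (L * / eps))).
      - apply ln_le_compat; [apply pow2_pos|]. nra.
      - rewrite !ln_mult by (try apply Rmult_lt_0_compat; lra).
        rewrite ln_pow2. pose proof (ln_le_sub_1 (/ eps) ltac:(lra)). simpl INR. lra. }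
    rewrite S_INR.
    assert (INR J2 <= 13 + 2 * (ln L + / eps)).
    { apply Rmult_le_reg_r with (ln 2); [lra|]. nra. }
    nra. }
  unfold identity_cost. rewrite !plus_INR, !mult_INR, pow_INR.
  replace (INR 1024) with 1024 by (rewrite INR_IZR_INZ; reflexivity).
  replace (INR 100) with 100 by (rewrite INR_IZR_INZ; reflexivity).
  replace (INR 2) with 2 by (simpl; lra).
  pose proof (mean_cost_le J0) as C0. pose proof (mean_cost_le J1) as C1.
  assert (C2 : 2 ^ J2 * INR (S J2) <= (5760 * L * / eps) * (16 * (1 + ln L) * / eps)).
  { apply Rmult_le_compat; auto; [left; apply pow2_pos|apply pos_INR]. }
  set (Y := / eps ^ 2) in *. set (V := L * (1 + ln L) / eps ^ 2).
  replace (5760 * L * / eps * (16 * (1 + ln L) * / eps)) with (92160 * V) in C2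
    by (unfold V; field; lra).
  assert (V1 : L / eps ^ 2 <= V).
  { unfold V. apply Rmult_le_compat_r; [fold Y; lra|nra]. }
  assert (V2 : 1 / eps ^ 2 <= V).
  { eapply Rle_trans; [|exact V1]. apply Rmult_le_compat_r; [fold Y; lra|lra]. }
  replace (20000 * L / eps ^ 2) with (20000 * (L / eps ^ 2)) in E0 by (unfold Rdiv; ring).
  replace (40960000 / eps ^ 2) with (40960000 * (1 / eps ^ 2)) in E1 by (field; lra).
  assert (V0 : 0 < 1 / eps ^ 2) by (unfold Rdiv; fold Y; lra).
  replace (2 ^ J2 * (100 * (1024 * INR (S J2))))
    with (102400 * (2 ^ J2 * INR (S J2))) by ring.
  lra.
Qed.

Lemma log2_ratio_ge_1 n eps :
  (2 <= n)%nat -> 0 < eps <= 1 -> 1 <= log2 (INR n / eps).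
Proof.
  intros Hn He. pose proof ln_2_range.
  apply Rmult_le_reg_r with (ln 2); [lra|]. rewrite log2_mul_ln2, Rmult_1_l.
  apply ln_le_compat; [lra|].
  assert (2 <= INR n) by (apply (le_INR 2) in Hn; simpl in Hn; lra).
  apply Rmult_le_reg_r with eps; [lra|].
  replace (INR n / eps * eps) with (INR n) by (field; lra). nra.
Qed.

Lemma identity_testing_upper_bound n eps q :
  (2 <= n)%nat -> 0 < eps <= 1 -> is_dist n q ->
  let L := log2 (INR n / eps) in
  exists N T, sound_tester n N T /\
    INR N <= 10 ^ 12 * (L * (1 + ln L) / eps ^ 2) /\
    distinguishes n q eps (1 / 3) T.
Proof.
  intros Hn He Hq L. pose proof (log2_ratio_ge_1 n eps Hn He) as HL. fold L in HL.
  assert (Hn2 : 2 <= INR n) by (apply (le_INR 2) in Hn; simpl in Hn; lra).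
  assert (Hie : 1 <= / eps) by (rewrite <- Rinv_1; apply Rinv_le_contravar; lra).
  assert (Ha : 2 <= INR n / eps) by (unfold Rdiv; nra).
  (* Makes m of order L while the last bucket has q-mass at most n / 2^m <= eps / 16. *)
  destruct (pow2_sandwich (16 * (INR n / eps))) as [m Hm]; [lra|].
  assert (Hm1 : (1 <= m)%nat) by (destruct m; [simpl in Hm; lra|lia]).
  assert (Hm0 : 1 <= INR m) by (apply (le_INR 1) in Hm1; exact Hm1).
  assert (Hsq : 1 <= sqrt (INR (S m))).
  { rewrite <- sqrt_1. apply sqrt_le_1_alt. rewrite S_INR; lra. }
  destruct (pow2_sandwich (80 / 3 * (sqrt (INR (S m)) / eps))) as [J0 H0];
    [unfold Rdiv; nra|].
  destruct (pow2_sandwich (3200 / eps)) as [J1 H1]; [unfold Rdiv; nra|].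
  destruct (pow2_sandwich (480 * INR m / eps)) as [J2 H2]; [unfold Rdiv; nra|].
  exists (identity_cost J0 J1 J2), (identity_tester n q m J0 J1 J2). split; [|split].
  - apply identity_tester_sound; auto; lia.
  - apply (identity_cost_bound (INR n / eps) L eps m); try tauto; try lra.
    unfold L. now rewrite log2_mul_ln2.
  - apply identity_tester_distinguishes; auto; try lia.
    + destruct Hm as [Hm _]. apply Rmult_le_compat_l with (r := eps) in Hm; [|lra].
      replace (eps * (16 * (INR n / eps))) with (16 * INR n) in Hm by (field; lra). exact Hm.
    + replace (3 / 80 * (eps / sqrt (INR (S m))))
        with (/ (80 / 3 * (sqrt (INR (S m)) / eps))) by (field; lra).
      apply Rinv_le_contravar; [unfold Rdiv; nra|tauto].
    + replace (eps / 3200) with (/ (3200 / eps)) by (field; lra).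
      apply Rinv_le_contravar; [unfold Rdiv; nra|tauto].
    + tauto.
Qed.

(** * A lower bound for testing uniformity *)

Lemma rsum_weighted_Cauchy n c g r :
  (forall i, (i < n)%nat -> 0 <= c i) ->
  (rsum n (fun i => c i * g i * r i)) ^ 2 <=
  rsum n (fun i => c i * g i ^ 2) * rsum n (fun i => c i * r i ^ 2).
Proof.
  intros Hc.
  pose proof (rsum_Cauchy_Schwarz n (fun i => sqrt (c i) * g i) (fun i => sqrt (c i) * r i)) as H.
  rewrite (rsum_ext n _ (fun i => c i * g i * r i)) in H.
  2:{ intros i Hi. rewrite <- (sqrt_sqrt (c i)) at 3 by auto. ring. }
  rewrite (rsum_ext n (fun i => (sqrt (c i) * g i) ^ 2) (fun i => c i * g i ^ 2)) in H.
  2:{ intros i Hi. rewrite <- (sqrt_sqrt (c i)) at 2 by auto. ring. }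
  rewrite (rsum_ext n (fun i => (sqrt (c i) * r i) ^ 2) (fun i => c i * r i ^ 2)) in H.
  2:{ intros i Hi. rewrite <- (sqrt_sqrt (c i)) at 2 by auto. ring. }
  exact H.
Qed.

(* [X] bounds the second moment, under [q], of the likelihood ratio of a single
   answer. *)
Definition likelihood_bound (n : nat) (p q : nat -> R) (X : R) : Prop :=
  1 <= X /\
  forall S, nonempty_qset n S ->
  exists g, (forall i, (i < n)%nat -> cond_prob n p S i = cond_prob n q S i * g i) /\
            rsum n (fun i => cond_prob n q S i * g i ^ 2) <= X.

(** Rejection under p is the q-mean of the likelihood ratio times the rejection indicator;
    Cauchy-Schwarz, applied one query at a time, costs a factor X per answer. *)
Lemma rejection_change_of_measure n p q X Qs D :
  (forall i, (i < n)%nat -> 0 <= p i) -> (forall i, (i < n)%nat -> 0 <= q i) ->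
  likelihood_bound n p q X -> Forall (nonempty_qset n) Qs ->
  (1 - accept_det n p Qs D) ^ 2 <= (1 - accept_det n q Qs D) * X ^ length Qs.
Proof.
  intros Hp Hq [HX Hlik] HQ. revert D. induction HQ as [|Q Qs HQ HQs IH]; intros D.
  { simpl. destruct (D []); lra. }
  destruct (Hlik Q HQ) as [g [Hg HgX]].
  assert (Hrej : forall p', 1 - accept_det n p' (Q :: Qs) D =
    rsum n (fun i => cond_prob n p' Q i * (1 - accept_det n p' Qs (fun ans => D (i :: ans))))).
  { intros p'. simpl. rewrite <- (cond_prob_mass n p' Q HQ) at 1.
    rewrite <- rsum_minus. apply rsum_ext; intros; ring. }
  rewrite !Hrej.
  set (rp := fun i => 1 - accept_det n p Qs (fun ans => D (i :: ans))).
  set (rq := fun i => 1 - accept_det n q Qs (fun ans => D (i :: ans))).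
  set (c := cond_prob n q Q).
  assert (Hc : forall i, (i < n)%nat -> 0 <= c i) by (intros; now apply cond_prob_nonneg).
  rewrite (rsum_ext n (fun i => cond_prob n p Q i * _) (fun i => c i * g i * rp i)).
  2:{ intros i Hi. rewrite Hg by exact Hi. reflexivity. }
  eapply Rle_trans; [apply rsum_weighted_Cauchy, Hc|].
  change (rsum n (fun i => c i * g i ^ 2) * rsum n (fun i => c i * rp i ^ 2) <=
          rsum n (fun i => c i * rq i) * X ^ S (length Qs)).
  assert (HXl : 0 < X ^ length Qs) by (apply pow_lt; lra).
  assert (Hstep : rsum n (fun i => c i * rp i ^ 2) <= rsum n (fun i => c i * rq i) * X ^ length Qs).
  { rewrite <- rsum_scal_r. apply rsum_le; intros i Hi.
    rewrite Rmult_assoc. apply Rmult_le_compat_l; [auto|]. apply IH. }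
  assert (0 <= rsum n (fun i => c i * rp i ^ 2)).
  { apply rsum_nonneg; intros i Hi. apply Rmult_le_pos; [auto|apply pow2_ge_0]. }
  simpl pow.
  replace (rsum n (fun i => c i * rq i) * (X * X ^ length Qs))
    with (X * (rsum n (fun i => c i * rq i) * X ^ length Qs)) by ring.
  apply Rmult_le_compat; auto.
  apply rsum_nonneg; intros i Hi. apply Rmult_le_pos; [auto|apply pow2_ge_0].
Qed.

Lemma valid_tester_Ex n T :
  valid_tester n T <->
  supp (fun s => Forall (nonempty_qset n) (queries s)) T /\ Ex T (fun _ => 1) = 1.
Proof.
  unfold valid_tester, supp. replace (fold_right _ 0 T) with (Ex T (fun _ => 1)); [tauto|].
  induction T as [|x T IH]; unfold Ex in *; simpl; [reflexivity|]. rewrite IH; lra.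
Qed.

(** Rejection has probability at most delta under q and at least 1 - delta under p. Jensen's
    inequality carries the bound for a fixed strategy over to the internal randomness. *)
Lemma tester_lower_bound n p q X T M eps delta :
  is_dist n p -> is_dist n q -> likelihood_bound n p q X -> eps <= dTV n p q ->
  valid_tester n T -> queries_at_most T (INR M) -> distinguishes n q eps delta T ->
  0 < delta < 1 ->
  (1 - delta) ^ 2 <= delta * X ^ M.
Proof.
  intros Hp Hq HX Hd HT HM [Hnull Halt] Hdelta.
  apply valid_tester_Ex in HT as [HT H1].
  specialize (Hnull q Hq (fun _ _ => eq_refl)).
  specialize (Halt p Hp (Rle_ge _ _ Hd)).
  assert (HTM : supp (fun s => Forall (nonempty_qset n) (queries s) /\
                              (length (queries s) <= M)%nat) T).
  { apply Forall_forall. intros ws Hin.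
    eapply Forall_forall in HT; [|exact Hin]. eapply Forall_forall in HM; [|exact Hin].
    apply INR_le in HM. tauto. }
  assert (E : forall r, 1 - accept_prob n r T =
     Ex T (fun s => 1 - accept_det n r (queries s) (decide s))).
  { intros r. rewrite Ex_minus, H1. reflexivity. }
  assert (HXM : 0 < X ^ M) by (apply pow_lt; destruct HX; lra).
  apply Rle_trans with ((1 - accept_prob n q T) * X ^ M);
    [|apply Rmult_le_compat_r; lra].
  apply Rle_trans with ((1 - accept_prob n p T) ^ 2); [apply pow_incr; lra|].
  rewrite !E. eapply Rle_trans; [eapply Ex_Jensen_sq; [exact HTM|exact H1]|].
  rewrite Rmult_comm, <- Ex_scal. eapply Ex_le; [exact HTM|].
  intros s [HQ Hlen]. simpl in *.
  pose proof (rejection_change_of_measure n p q X (queries s) (decide s)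
                (proj1 Hp) (proj1 Hq) HX HQ) as H.
  eapply Rle_trans; [exact H|]. rewrite Rmult_comm.
  pose proof (accept_det_range n q (queries s) (decide s) (proj1 Hq) HQ).
  apply Rmult_le_compat_r; [lra|]. apply Rle_pow; [apply HX|exact Hlen].
Qed.

(** * A hard perturbation of the uniform distribution *)

Definition uniform (n : nat) : nat -> R := fun _ => / INR n.

(** The mass x (n - u) / n removed from the elements from u on is spread evenly over the first u, so
    the total stays 1. *)
Definition two_valued (n u : nat) (x : R) : nat -> R :=
  fun i => (if (i <? u)%nat then 1 + x * (INR n - INR u) / INR u else 1 - x) / INR n.

Lemma rsum_two_valued n u a b :
  (u <= n)%nat ->
  rsum n (fun i => if (i <? u)%nat then a else b) = INR u * a + (INR n - INR u) * b.
Proof.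
  intros Hu. induction Hu as [|n Hu IH].
  - rewrite (rsum_ext u _ (fun _ => a)); [rewrite rsum_const; lra|].
    intros i Hi. now apply Nat.ltb_lt in Hi as ->.
  - rewrite rsum_S, IH, S_INR. destruct (Nat.ltb_spec n u); [lia|lra].
Qed.

Lemma uniform_dist n : (1 <= n)%nat -> is_dist n (uniform n).
Proof.
  intros Hn. assert (0 < INR n) by (apply lt_0_INR; lia). unfold uniform. split.
  - intros i _. left. now apply Rinv_0_lt_compat.
  - rewrite rsum_const. field; lra.
Qed.

Lemma two_valued_dist n u x :
  (1 <= u <= n)%nat -> 0 <= x <= 1 -> is_dist n (two_valued n u x).
Proof.
  intros Hu Hx. assert (0 < INR u) by (apply lt_0_INR; lia).
  assert (INR u <= INR n) by (apply le_INR; lia). unfold two_valued. split.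
  - intros i _. apply Rle_mult_inv_pos; [|lra]. destruct (i <? u)%nat; [|lra].
    assert (0 <= x * (INR n - INR u) / INR u); [|lra].
    apply Rle_mult_inv_pos; [nra|lra].
  - unfold Rdiv at 1. rewrite rsum_scal_r, rsum_two_valued by lia. field; lra.
Qed.

Lemma two_valued_dTV n u x :
  (1 <= u <= n)%nat -> 0 <= x ->
  dTV n (two_valued n u x) (uniform n) = x * (INR n - INR u) / INR n.
Proof.
  intros Hu Hx. assert (0 < INR u) by (apply lt_0_INR; lia).
  assert (INR u <= INR n) by (apply le_INR; lia). unfold dTV, two_valued, uniform.
  assert (H1 : 0 <= x * (INR n - INR u) / INR u) by (apply Rle_mult_inv_pos; [nra|lra]).
  rewrite (rsum_ext n _ (fun i => (if (i <? u)%nat then x * (INR n - INR u) / INR u else x) * / INR n)).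
  - rewrite rsum_scal_r, rsum_two_valued by lia. field; lra.
  - intros i _. assert (Hi : 0 < / INR n) by (apply Rinv_0_lt_compat; lra).
    destruct (i <? u)%nat.
    + replace (_ / INR n - / INR n) with (x * (INR n - INR u) / INR u * / INR n)
        by (field; lra).
      apply Rabs_right. nra.
    + replace (_ / INR n - / INR n) with (- (x * / INR n)) by (field; lra).
      rewrite Rabs_Ropp. apply Rabs_right. nra.
Qed.

(** With v = n p, and s, V, Q the sums of 1, v, v^2 over S, the second moment is s Q / V^2, and s Q
    - V^2 is s times the sum of (v - 1)^2, minus (V - s)^2. The bounds 4 x on |v - 1| and V >= s / 4
    give 16 . 16 x^2 whatever S is, so no choice of the query set helps. *)
Lemma bounded_ratio_likelihood n p x :
  (1 <= n)%nat -> 0 <= x ->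
  (forall i, (i < n)%nat -> / 4 <= INR n * p i /\ Rabs (INR n * p i - 1) <= 4 * x) ->
  likelihood_bound n p (uniform n) (1 + 256 * x ^ 2).
Proof.
  intros Hn Hx Hp. assert (Hn0 : 0 < INR n) by (apply lt_0_INR; lia).
  split; [pose proof (pow2_ge_0 x); lra|]. intros S HS.
  pose proof (sizeS_pos n S HS) as Hs. set (s := sizeS n S) in *.
  assert (Es : massS n (fun _ => 1) S = s) by reflexivity.
  set (v := fun i => INR n * p i).
  set (V := massS n v S).
  assert (HV : / 4 * s <= V).
  { rewrite <- Es, <- massS_scal. apply massS_le; intros i Hi _. unfold v.
    specialize (Hp i Hi). lra. }
  assert (HMp : massS n p S = V / INR n).
  { unfold V, v. rewrite massS_scal. field; lra. }
  assert (HMq : massS n (uniform n) S = s / INR n).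
  { unfold uniform. rewrite (massS_ext n _ (fun _ => / INR n * 1)) by (intros; lra).
    rewrite massS_scal, Es. unfold Rdiv; ring. }
  assert (HqS : forall i, cond_prob n (uniform n) S i = if S i then / s else 0).
  { intros i. unfold cond_prob. destruct (S i); [|reflexivity].
    destruct (Req_dec_T _ 0) as [|H0]; [reflexivity|].
    rewrite HMq. unfold uniform. field; lra. }
  exists (fun i => v i * s / V). split.
  - intros i Hi. rewrite HqS. unfold cond_prob. destruct (S i); [|lra].
    assert (0 < V / INR n) by (apply Rdiv_lt_0_compat; lra).
    destruct (Req_dec_T _ 0) as [H0|H0]; [rewrite HMp in H0; lra|].
    rewrite HMp. unfold v. field; lra.
  - rewrite (rsum_ext n _ (fun i => s / V ^ 2 * (if S i then v i ^ 2 else 0))).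
    2:{ intros i _. rewrite HqS. destruct (S i); field; lra. }
    rewrite rsum_scal. fold (massS n (fun i => v i ^ 2) S).
    assert (Hvar : massS n (fun i => v i ^ 2) S - 2 * V + s <= 16 * x ^ 2 * s).
    { rewrite <- Es, <- massS_scal. unfold V. rewrite <- massS_scal, <- massS_minus, <- massS_plus.
      apply massS_le; intros i Hi _. specialize (Hp i Hi). destruct Hp as [_ Hp].
      fold (v i) in Hp.
      replace (v i ^ 2 - 2 * v i + 1) with (Rabs (v i - 1) ^ 2) by (rewrite pow2_abs; ring).
      replace (16 * x ^ 2 * 1) with ((4 * x) ^ 2) by ring.
      apply pow_incr. split; [apply Rabs_pos|exact Hp]. }
    set (Q := massS n (fun i => v i ^ 2) S) in *.
    assert (HV2 : 0 < V ^ 2) by (apply pow_lt; lra).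
    apply Rmult_le_reg_r with (V ^ 2); [exact HV2|].
    replace (s / V ^ 2 * Q * V ^ 2) with (s * Q) by (field; lra).
    assert (s * Q <= V ^ 2 + 16 * (x ^ 2 * s ^ 2)).
    { pose proof (pow2_ge_0 (V - s)).
      apply Rmult_le_compat_l with (r := s) in Hvar; [|lra]. nra. }
    assert (s ^ 2 <= 16 * V ^ 2).
    { replace (16 * V ^ 2) with ((4 * V) ^ 2) by ring. apply pow_incr; lra. }
    pose proof (pow2_ge_0 x). nra.
Qed.

Lemma uniformity_lower_bound n eps delta T M :
  (2 <= n)%nat -> 0 < eps <= 1 -> ((3 <= n)%nat \/ eps <= 3 / 4) -> 0 < delta <= / 100 ->
  valid_tester n T -> queries_at_most T (INR M) ->
  distinguishes n (uniform n) (eps / 2) delta T ->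
  ln (/ (2 * delta)) <= 256 * eps ^ 2 * INR M.
Proof.
  intros Hn He Hcase Hdelta HT HM HD.
  (* About a third of the domain: removing mass from the other two thirds keeps x below eps, and n
     <= 5 u bounds the increase on the first u elements by 4 x. *)
  set (u := Nat.max 1 (n / 3)).
  assert (Hdiv : (3 * (n / 3) <= n < 3 * (n / 3) + 3)%nat).
  { pose proof (Nat.div_mod_eq n 3). pose proof (Nat.mod_upper_bound n 3). lia. }
  assert (Hu : (1 <= u < n)%nat) by (unfold u; lia).
  assert (Hu5 : INR n <= 5 * INR u).
  { replace 5 with (INR 5) by (simpl; lra). rewrite <- mult_INR. apply le_INR. unfold u; lia. }
  assert (Hu0 : 0 < INR u) by (apply lt_0_INR; lia).
  assert (Hun : INR u < INR n) by (apply lt_INR; lia).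
  (* Chosen so that the distance to uniform is exactly eps / 2. It is at most 3/4 eps for n >= 3 but
     equals eps for n = 2, whence the case hypothesis: x <= 3/4 keeps all values at least 1 / (4
     n). *)
  set (x := eps * INR n / (2 * (INR n - INR u))).
  assert (Hx0 : 0 <= x) by (apply Rle_mult_inv_pos; nra).
  assert (Hxb : x <= 3 / 4 /\ x <= eps).
  { unfold x. destruct (Nat.le_gt_cases 3 n) as [H3|H3].
    - assert (3 * INR u <= INR n).
      { replace 3 with (INR 3) by (simpl; lra). rewrite <- mult_INR. apply le_INR.
        unfold u; lia. }
      assert (eps * INR n / (2 * (INR n - INR u)) <= 3 / 4 * eps); [|lra].
      apply Rmult_le_reg_r with (2 * (INR n - INR u)); [lra|].
      replace (eps * INR n / (2 * (INR n - INR u)) * (2 * (INR n - INR u)))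
        with (eps * INR n) by (field; lra). nra.
    - assert (n = 2%nat) by lia. subst n. simpl in *.
      replace (eps * (1 + 1) / (2 * (1 + 1 - 1))) with eps by field.
      destruct Hcase; [lia|lra]. }
  set (p := two_valued n u x).
  assert (Hp : is_dist n p) by (apply two_valued_dist; [lia|lra]).
  assert (Hd : eps / 2 <= dTV n p (uniform n)).
  { unfold p. rewrite two_valued_dTV by (lia || lra). right. unfold x. field; lra. }
  assert (Hlik : likelihood_bound n p (uniform n) (1 + 256 * x ^ 2)).
  { apply bounded_ratio_likelihood; [lia|lra|]. intros i Hi.
    unfold p, two_valued.
    replace (INR n * (_ / INR n))
      with (if (i <? u)%nat then 1 + x * (INR n - INR u) / INR u else 1 - x)
      by (field; lra).
    assert (Hr : 0 <= (INR n - INR u) / INR u <= 4).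
    { split; [apply Rle_mult_inv_pos; lra|].
      apply Rmult_le_reg_r with (INR u); [lra|].
      replace ((INR n - INR u) / INR u * INR u) with (INR n - INR u) by (field; lra). lra. }
    unfold Rdiv in *. rewrite Rmult_assoc. set (r := (INR n - INR u) * / INR u) in *.
    destruct (i <? u)%nat.
    - split; [nra|]. replace (1 + x * r - 1) with (x * r) by ring.
      rewrite Rabs_right by nra. nra.
    - split; [lra|]. replace (1 - x - 1) with (- x) by ring.
      rewrite Rabs_Ropp, Rabs_right by lra. lra. }
  pose proof (tester_lower_bound n p (uniform n) _ T M (eps / 2) delta Hp
    (uniform_dist n ltac:(lia)) Hlik Hd HT HM HD ltac:(lra)) as H.
  assert (HXe : (1 + 256 * x ^ 2) ^ M <= exp (256 * eps ^ 2 * INR M)).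
  { rewrite (Rmult_comm _ (INR M)), exp_INR_mult. apply pow_incr.
    assert (x ^ 2 <= eps ^ 2) by (apply pow_incr; lra).
    pose proof (pow2_ge_0 x). pose proof (exp_ineq1_le (256 * eps ^ 2)). lra. }
  rewrite <- (ln_exp (256 * eps ^ 2 * INR M)). apply ln_le_compat.
  - apply Rinv_0_lt_compat; lra.
  (* As delta <= 1/100, (1 - delta)^2 is at least 1/2. *)
  - apply Rmult_le_reg_l with (2 * delta); [lra|]. rewrite Rinv_r by lra.
    apply Rmult_le_compat_l with (r := delta) in HXe; [|lra]. nra.
Qed.

(** * The reduction *)

Lemma sound_tester_valid n N T : sound_tester n N T -> valid_tester n T.
Proof.
  intros [HT H1]. apply valid_tester_Ex. split; [|exact H1].
  eapply supp_impl; [|exact HT]. simpl; tauto.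
Qed.

Lemma sound_tester_queries n N T b :
  sound_tester n N T -> INR N <= b -> queries_at_most T b.
Proof.
  intros [HT _] Hb. eapply Forall_impl; [|exact HT]. intros ws [_ [_ Hlen]].
  apply le_INR in Hlen. lra.
Qed.

(** log2 (1.01) is at most 0.02 and log2 (100 n / eps) exceeds L + 1, so 1 / (2 delta) is far above
    3 L, and ln 3 >= 1. *)
Lemma confidence_bounds n eps :
  (2 <= n)%nat -> 0 < eps <= 1 ->
  let L := log2 (INR n / eps) in
  let delta := log2 (1 + 1 / 100) / (6 * log2 (100 * INR n / eps)) in
  0 < delta <= / 100 /\ 1 + ln L <= ln (/ (2 * delta)).
Proof.
  intros Hn He L delta. pose proof ln_2_range as Hln2.
  pose proof (log2_ratio_ge_1 n eps Hn He) as HL. fold L in HL.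
  assert (Hn2 : 2 <= INR n) by (apply (le_INR 2) in Hn; simpl in Hn; lra).
  assert (Ha : 0 < INR n / eps) by (apply Rdiv_lt_0_compat; lra).
  set (l := log2 (1 + 1 / 100)) in *. set (L' := log2 (100 * INR n / eps)) in *.
  assert (Hl : 0 < l <= 2 / 100).
  { pose proof (log2_mul_ln2 (1 + 1 / 100)) as E. fold l in E.
    pose proof (ln_le_sub_1 (1 + 1 / 100) ltac:(lra)).
    assert (0 < ln (1 + 1 / 100)) by (rewrite <- ln_1; apply ln_increasing; lra).
    split; nra. }
  assert (HL' : L + 1 <= L').
  { apply Rmult_le_reg_r with (ln 2); [lra|]. unfold L, L'.
    rewrite Rmult_plus_distr_r, !log2_mul_ln2, Rmult_1_l.
    rewrite <- ln_mult by lra. apply ln_le_compat; [nra|].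
    unfold Rdiv in *. nra. }
  assert (E : / (2 * delta) = 3 * L' / l) by (unfold delta; field; lra).
  assert (Hd0 : 0 < delta) by (apply Rdiv_lt_0_compat; lra).
  split; [split; [exact Hd0|]|].
  - unfold delta. apply Rmult_le_reg_r with (6 * L'); [lra|].
    replace (l / (6 * L') * (6 * L')) with l by (field; lra). lra.
  - rewrite E. apply Rle_trans with (ln (3 * L)).
    + rewrite ln_mult by lra. pose proof exp_le_3.
      rewrite <- (ln_exp 1) at 1. pose proof (ln_le_compat (exp 1) 3 (exp_pos 1) H). lra.
    + apply ln_le_compat; [lra|]. apply Rmult_le_reg_r with l; [lra|].
      replace (3 * L' / l * l) with (3 * L') by (field; lra). nra.
Qed.

Theorem theorem6p1 :
  exists C : R, 0 < C /\
  forall m : nat -> R -> R -> nat,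
    (forall (n : nat) (eps delta : R) (q : nat -> R),
       (1 <= n)%nat -> 0 < eps <= 1 -> 0 < delta < 1 ->
       is_dist n q -> near_uniform n q ->
       exists T : tester,
         valid_tester n T /\ queries_at_most T (INR (m n eps delta)) /\
         distinguishes n q eps delta T) ->
    forall (n : nat) (eps : R) (q : nat -> R),
      (1 <= n)%nat -> 0 < eps <= 1 -> is_dist n q ->
      exists T : tester,
        valid_tester n T /\
        queries_at_most T
          (C * (log2 (INR n / eps) *
                INR (m n (eps / 2)
                       (log2 (1 + 1 / 100) / (6 * log2 (100 * INR n / eps))))
                + sqrt (log2 (INR n / eps)) / eps ^ 2)) /\
        distinguishes n q eps (1 / 3) T.
Proof.
  (* 10^12 comes from the cost of the tester, 256 from the lower bound on m. *)
  exists (256 * 10 ^ 12). split; [lra|]. intros m Hm n eps q Hn He Hq.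
  set (L := log2 (INR n / eps)).
  set (delta := log2 (1 + 1 / 100) / (6 * log2 (100 * INR n / eps))).
  set (M := m n (eps / 2) delta).
  assert (HM0 : 0 <= INR M) by apply pos_INR.
  assert (Hsq0 : 0 <= sqrt L / eps ^ 2)
    by (apply Rle_mult_inv_pos; [apply sqrt_pos|apply pow_lt; lra]).
  assert (Hie : 1 <= / eps) by (rewrite <- Rinv_1; apply Rinv_le_contravar; lra).
  (* For n = 1 and eps = 1, L is 0 and so is the budget; on one point all distributions agree and no
     query is made. *)
  destruct (Nat.eq_dec n 1) as [->|Hn1].
  - exists trivial_tester. pose proof (trivial_tester_sound 1) as HT.
    split; [now apply sound_tester_valid with 0%nat|split].
    + eapply sound_tester_queries; [exact HT|]. simpl INR.
      assert (0 <= L).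
      { unfold L, log2, Rdiv. apply Rle_mult_inv_pos; [|pose proof ln_2_range; lra].
        rewrite <- ln_1. apply ln_le_compat; simpl; lra. }
      pose proof (Rmult_le_pos _ _ H HM0). lra.
    + split; intros p Hp Hpq.
      * rewrite trivial_tester_accept. lra.
      * exfalso. destruct Hp as [_ Hp], Hq as [_ Hq]. unfold dTV in Hpq. simpl in *.
        replace (p 0%nat - q 0%nat) with 0 in Hpq by lra. rewrite Rabs_R0 in Hpq. lra.
  - assert (Hn2 : (2 <= n)%nat) by lia.
    destruct (identity_testing_upper_bound n eps q Hn2 He Hq) as [N [T [HT [HN HD]]]].
    fold L in HN. exists T. split; [now apply sound_tester_valid with N|].
    split; [|exact HD]. apply sound_tester_queries with n N; [exact HT|].
    eapply Rle_trans; [exact HN|].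
    pose proof (log2_ratio_ge_1 n eps Hn2 He) as HL. fold L in HL.
    assert (Hie2 : 0 < / eps ^ 2) by (apply Rinv_0_lt_compat, pow_lt; lra).
    assert (HLM : 0 <= L * INR M) by (apply Rmult_le_pos; lra).
    rewrite (Rmult_comm 256), Rmult_assoc. apply Rmult_le_compat_l; [lra|].
    (* For n = 2 and eps close to 1 the lower bound on m does not apply, but then L <= 2
       and the term in sqrt L is large enough. *)
    assert (Hcase : ((3 <= n)%nat \/ eps <= 3 / 4) \/ (n = 2%nat /\ 3 / 4 < eps)).
    { destruct (Nat.le_gt_cases 3 n); [now do 2 left|].
      destruct (Rle_dec eps (3 / 4)); [left; now right|right; split; [lia|lra]]. }
    destruct Hcase as [Hcase|[-> Heps]].
    + destruct (confidence_bounds n eps Hn2 He) as [Hd Hln]. fold delta L in Hd, Hln.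
      (* The uniform distribution is near uniform with deviation 0, so the assumed tester for it
         bounds [M] from below. *)
      destruct (Hm n (eps / 2) delta (uniform n)) as [T' [V' [Q' D']]];
        [lia|lra|lra|now apply uniform_dist| |].
      { intros i _. unfold uniform. rewrite Rminus_diag, Rabs_R0.
        assert (0 < INR n) by (apply lt_0_INR; lia).
        left. apply Rinv_0_lt_compat; lra. }
      fold M in Q'.
      pose proof (uniformity_lower_bound n eps delta T' M Hn2 He Hcase Hd V' Q' D') as HLB.
      apply Rle_trans with (L * (256 * eps ^ 2 * INR M) / eps ^ 2).
      * apply Rmult_le_compat_r; [lra|]. apply Rmult_le_compat_l; lra.
      * replace (L * (256 * eps ^ 2 * INR M) / eps ^ 2) with (256 * (L * INR M))
          by (field; lra). lra.
    + assert (HL2 : L <= 2).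
      { pose proof ln_2_range. apply Rmult_le_reg_r with (ln 2); [lra|].
        unfold L. rewrite log2_mul_ln2.
        replace (2 * ln 2) with (ln (2 ^ 2)) by (rewrite ln_pow2; simpl; lra). apply ln_le_compat.
        - apply Rdiv_lt_0_compat; simpl; lra.
        - apply Rmult_le_reg_r with eps; [lra|].
          replace (INR 2 / eps * eps) with 2 by (simpl; field; lra). simpl; lra. }
      assert (Hs : 1 <= sqrt L) by (rewrite <- sqrt_1; now apply sqrt_le_1_alt).
      pose proof (ln_le_sub_1 L ltac:(lra)) as HlnL.
      (* L (1 + ln L) <= L^2 <= 4, while sqrt L >= 1. *)
      apply Rle_trans with (256 * (sqrt L / eps ^ 2)); [|lra].
      unfold Rdiv. rewrite <- Rmult_assoc. apply Rmult_le_compat_r; [lra|]. nra.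
Qed.
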